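(* Let $\{a_n\}_{n\in\mathbb Z}$ be a separated sequence of real numbers, indexed in increasing order, with $a_n\to\pm\infty$ as $n\to\pm\infty$, and let $\Delta_n := a_{n+1}-a_n$ for $n>0$ and $\Delta_n := a_n-a_{n-1}$ for $n\le 0$. Suppose that at least one of the following conditions holds: (1) $\Delta_{n+1}\asymp\Delta_n$ and $\dfrac{\ln|a_n|}{\ln\ln\Delta_n}\lesssim \Delta_n\lesssim \ln|a_n|$; (2) $\Delta_{n+1}\asymp\Delta_n$ and $\Delta_n\gtrsim(\ln|a_n|)^2$; (3) there is a $d>0$ such that the set $\{a_n : n\in\mathbb Z\}$ can be partitioned into finite clusters $\{a_n^j\}_{1\le j\le m_n}$, $n\in\mathbb Z$, enumerated in increasing order (that is, $a_n^1<\dots<a_n^{m_n}$ and $a_n^{m_n}<a_{n+1}^1$ for every $n$) and consisting of nonzero points, with $\sup_n m_n<\infty$, such that $\dfrac{a_n^{j}}{a_n^{j+1}}\to 1$ as $|n|\to\infty$ for consecutive points of the same cluster ($1\le j<m_n$), and such that for successive clusters $\dfrac{a_{n+1}^{j}}{a_n^{l}}-1>d$ for all $n\ge 0$ and all $1\le j\le m_{n+1}$, $1\le l\le m_n$, and $\dfrac{a_{n-1}^{j}}{a_n^{l}}-1>d$ for all $n<0$ and all $1\le j\le m_{n-1}$, $1\le l\le m_n$. Then there exists a meromorphic inner function $\Theta$ on $\mathbb C_+$ with spectrum $\sigma(\Theta)=\{a_n\}$ such that $|\Theta'|$ is uniformly bounded on $\mathbb R$.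
   Context: $\mathbb C_+$ is the open upper half-plane. An inner function on $\mathbb C_+$ is a bounded analytic function on $\mathbb C_+$ with unit modulus almost everywhere on $\mathbb R$ (boundary values). A meromorphic inner function (MIF) is an inner function on $\mathbb C_+$ that has a meromorphic continuation to $\mathbb C$. The spectrum of an MIF $\Theta$ is the level set $\sigma(\Theta)=\{x\in\mathbb R:\Theta(x)=1\}$. A sequence $\{a_n\}$ is separated if there is $\delta>0$ with $|a_n-a_m|>\delta$ for all $n\ne m$. Notation: $f(n)\lesssim g(n)$ (equivalently $g(n)\gtrsim f(n)$) means that there is a constant $c\ge 0$ with $f(n)\le c\,g(n)$ for all large enough $|n|$; $f(n)\asymp g(n)$ means that there are constants $c_1,c_2>0$ with $c_1f(n)\le g(n)\le c_2f(n)$ for all large enough $|n|$. In condition (1) the quantity $\ln|a_n|/\ln\ln\Delta_n$ is understood to be defined for all large enough $|n|$. *)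

(* Defs.v *)
From HB Require Import structures.
From mathcomp Require Import all_boot all_order all_algebra.
From mathcomp Require Import complex.
From mathcomp Require Import all_classical all_reals all_analysis.

Set Implicit Arguments.
Unset Strict Implicit.
Unset Printing Implicit Defensive.

Import Order.TTheory GRing.Theory Num.Theory.
Import numFieldNormedType.Exports.

Local Open Scope classical_set_scope.
Local Open Scope ring_scope.

(* Packaging [R[i]] as a [numClosedFieldType] gives it the norm topology of
   [numFieldNormedType], so that [derivable] over [cplx R] is complex
   differentiability.  Norms in [cplx R] are elements of [cplx R] with zero
   imaginary part. *)
Definition cplx (R : realType) : numClosedFieldType := R[i].

Definition toC {R : realType} (x y : R) : cplx R := (x +i* y)%C.

Definition ofreal {R : realType} (x : R) : cplx R := (x%:C)%C.

Definition upper_half_plane (R : realType) : set (cplx R) :=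
  [set z | 0 < complex.Im z].

Definition analytic_at {R : realType} (f : cplx R -> cplx R) (p : cplx R) : Prop :=
  \forall z \near p, derivable f z 1.

Definition pole_at {R : realType} (f : cplx R -> cplx R) (p : cplx R) : Prop :=
  exists (k : nat) (g : cplx R -> cplx R),
    [/\ (0 < k)%N, analytic_at g p, g p != 0 &
        \forall z \near p^', f z = g z / (z - p) ^+ k].

(* The value of a meromorphic function at a pole is arbitrary. *)
Definition meromorphic {R : realType} (f : cplx R -> cplx R) : Prop :=
  forall p, analytic_at f p \/ pole_at f p.

(* Only the values of [f] on the upper half-plane are constrained; boundary
   values are the limits along vertical segments. *)
Definition inner_function {R : realType} (f : cplx R -> cplx R) : Prop :=
  [/\ forall z, upper_half_plane z -> analytic_at f z,
      exists M : R, forall z, upper_half_plane z -> `|f z| <= ofreal M &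
      {ae lebesgue_measure, forall x : R,
         exists2 w : cplx R, f (toC x y) @[y --> 0^'+] --> w & `|w| = 1}].

(* A meromorphic inner function is identified with its (unique) meromorphic
   continuation to the plane. *)
Definition meromorphic_inner_function {R : realType} (f : cplx R -> cplx R) : Prop :=
  inner_function f /\ meromorphic f.

Definition spectrum {R : realType} (f : cplx R -> cplx R) : set R :=
  [set x | f (ofreal x) = 1].

Definition separated_seq {R : realType} (a : int -> R) : Prop :=
  exists2 delta : R, 0 < delta & forall n m : int, n != m -> delta < `|a n - a m|.

Definition gap {R : realType} (a : int -> R) (n : int) : R :=
  if 0 < n then a (n + 1) - a n else a n - a (n - 1).

Definition for_large_abs (P : int -> Prop) : Prop :=
  exists N : nat, forall n : int, (N <= `|n|)%N -> P n.

Definition lesssim {R : realType} (f g : int -> R) : Prop :=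
  exists2 c : R, 0 <= c & for_large_abs (fun n => f n <= c * g n).

Definition asymp {R : realType} (f g : int -> R) : Prop :=
  exists c1 c2 : R,
    [/\ 0 < c1, 0 < c2 & for_large_abs (fun n => c1 * f n <= g n <= c2 * f n)].

(* [ln] is total (0 on nonpositive numbers) and so is division; the second
   clause makes the quotient in the third one genuinely defined. *)
Definition log_gap_condition {R : realType} (a : int -> R) : Prop :=
  let D := gap a in
  [/\ asymp (fun n => D (n + 1)) D,
      for_large_abs (fun n => [/\ a n != 0, 1 < D n & ln (ln (D n)) != 0]),
      lesssim (fun n => ln `|a n| / ln (ln (D n))) D &
      lesssim D (fun n => ln `|a n|)].

Definition large_gap_condition {R : realType} (a : int -> R) : Prop :=
  let D := gap a in
  asymp (fun n => D (n + 1)) D /\ lesssim (fun n => ln `|a n| ^+ 2) D.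

(* The [n]-th cluster is [b n 1 < ... < b n (m n)]; values [b n j] with [j]
   outside [1 .. m n] are irrelevant.  Disjointness of the clusters follows
   from the enumeration being increasing. *)
Definition cluster_condition {R : realType} (a : int -> R) : Prop :=
  exists (d : R) (m : int -> nat) (b : int -> nat -> R),
    let J (n : int) : set nat := [set j | (1 <= j <= m n)%N] in
    [/\ 0 < d,
        [/\ range a = \bigcup_n (b n @` J n),
            forall n, (1 <= m n)%N,
            forall n j, (1 <= j < m n)%N -> b n j < b n j.+1,
            forall n, b n (m n) < b (n + 1) 1%N &
            forall n j, J n j -> b n j != 0],
        exists M : nat, forall n, (m n <= M)%N,
        forall e : R, 0 < e -> for_large_abs (fun n =>
          forall j, (1 <= j < m n)%N -> `|b n j / b n j.+1 - 1| < e) &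
        (forall n : int, 0 <= n -> forall j l, J (n + 1) j -> J n l ->
           d < b (n + 1) j / b n l - 1) /\
        (forall n : int, n < 0 -> forall j l, J (n - 1) j -> J n l ->
           d < b (n - 1) j / b n l - 1)].

(* Main.v *)
Require Import Defs.
From HB Require Import structures.
From mathcomp Require Import all_boot all_order all_algebra.
From mathcomp Require Import complex.
From mathcomp Require Import all_classical all_reals all_analysis.
From mathcomp Require Import zify ring lra.

Import Order.TTheory GRing.Theory Num.Theory.
Import numFieldNormedType.Exports.

Local Open Scope classical_set_scope.
Local Open Scope ring_scope.

(** The inner function is Theta = (H - i) / (H + i), where
      H(z) = sum_k w_k (1 / (a_k - z) - 1 / (a_k - a_0))
    is a Herglotz function with positive weights w_k still to be chosen: its
    imaginary part is positive in the upper half-plane and it is real on the real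
    line, so that Theta is inner and equals 1 exactly at the poles a_k of H.

    Near a_n write H = w_n / (a_n - z) + G_n ([regular_part]).  Then
      Theta = 1 - 2i (z - a_n) / D_n,   D_n = - w_n + (z - a_n) (G_n + i),
    an expression without singularity at a_n ([thetaE]).  For a real x whose nearest
    pole is a_n, and t = x - a_n, this gives
      |Theta'(x)| = 2 (w_n + t^2 G_n'(x)) / ((t G_n(x) - w_n)^2 + t^2),
    which is bounded as soon as w_n is bounded below, G_n' is bounded, and G_n(x)^2 is
    O(w_n) ([derive_bound]).  So everything reduces to a choice of weights
    ([inner_function_of_weights]).  Off the real line, Theta is a quotient of analytic
    functions; the order of a zero p of H + i is finite, since otherwise H would be
    constant on the segment from p to the nearest pole ([taylor_not_all0]).

    Under [large_gap_condition] or [cluster_condition] all weights are 1.  Some fixed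
    number M of steps from a_j advances by at least a multiple of ln^2 (2 + |j|)
    ([large_gap_growth], [cluster_growth]); for clusters because M steps leave the
    cluster and the advance is then proportional to |a_j|.  Hence |a_(n+m) - a_n| is
    at least a multiple of m ln^2 m ([gap_growth]), and the sums of 1 / |a_k - a_n|
    over k <> n are bounded uniformly in n ([inverse_sum_bounded]), which bounds G_n
    and G_n'.

    Under [log_gap_condition] the weight w_k is a_(k+1) - a_k.  Now G_n(x) is, up to
    terms independent of n, a Riemann sum of the integral of 1 / (t - x), whose
    principal value vanishes; the error is at most the sum of (w_k / (a_k - a_n))^2
    ([pole_sum_log]).  That sum is about the largest gap seen from a_n divided by w_n,
    hence O(ln |a_n| / w_n), and the lower bound on the gaps gives
    ln |a_n| = O(w_n^(3/2)), so G_n(x) = O(sqrt w_n) as required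
    ([step_weight_balance]).  When the gaps are below e, their iterated logarithm is
    negative and the lower bound says nothing; but then the gaps are bounded on a
    whole side of the sequence ([regular_dichotomy]), and the same estimate holds
    ([step_weight_dominated]). *)

Set Implicit Arguments.
Unset Strict Implicit.
Unset Printing Implicit Defensive.

(** * Moduli, symmetric sums and complex series *)

(** The norm of [cplx R] takes its values in [cplx R], whose order is partial;
    a modulus in [R] allows arguments by linear arithmetic. *)
Definition modc {R : realType} (z : cplx R) : R := ComplexField.Normc.normc z.

Section Modulus.
Variable R : realType.
Implicit Types (x y z : cplx R).

Lemma normE z : `|z| = ofreal (modc z).
Proof. by []. Qed.

Lemma modcE z : modc z = Num.sqrt (complex.Re z ^+ 2 + complex.Im z ^+ 2).
Proof. by case: z. Qed.

Lemma modc_ge0 z : 0 <= modc z.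
Proof. by rewrite modcE sqrtr_ge0. Qed.

Lemma sqr_modc z : modc z ^+ 2 = complex.Re z ^+ 2 + complex.Im z ^+ 2.
Proof. by rewrite modcE sqr_sqrtr // addr_ge0 ?sqr_ge0. Qed.

Lemma modcD x y : modc (x + y) <= modc x + modc y.
Proof. exact: (@le_normcD R x y). Qed.

Lemma modcM x y : modc (x * y) = modc x * modc y.
Proof. exact: ComplexField.Normc.normcM. Qed.

Lemma modcV x : modc x^-1 = (modc x)^-1.
Proof. exact: ComplexField.Normc.normcV. Qed.

Lemma modcN x : modc (- x) = modc x.
Proof. exact: (@normcN R x). Qed.

Lemma modcB x y : modc (x - y) = modc (y - x).
Proof. by rewrite -modcN opprB. Qed.

Lemma modc0 : modc (0 : cplx R) = 0.
Proof. exact: ComplexField.Normc.normc0. Qed.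

Lemma modc1 : modc (1 : cplx R) = 1.
Proof. exact: ComplexField.Normc.normc1. Qed.

Lemma modcX x n : modc (x ^+ n) = modc x ^+ n.
Proof.
by elim: n => [|n IHn]; rewrite ?expr0 ?modc1 // !exprS modcM IHn.
Qed.

Lemma modc_eq0 z : (modc z == 0) = (z == 0).
Proof.
apply/eqP/eqP => [|->]; last exact: modc0.
exact: ComplexField.Normc.eq0_normc.
Qed.

Lemma modc_gt0 z : (0 < modc z) = (z != 0).
Proof. by rewrite lt_def modc_ge0 andbT modc_eq0. Qed.

Lemma modc_ofreal (r : R) : modc (ofreal r) = `|r|.
Proof. by rewrite modcE /= expr0n /= addr0 sqrtr_sqr. Qed.

Lemma modc_i : modc ('i%C : cplx R) = 1.
Proof. by rewrite modcE /= expr0n /= add0r expr1n sqrtr1. Qed.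

Lemma Re_le_modc z : `|complex.Re z| <= modc z.
Proof. by rewrite modcE -sqrtr_sqr ler_wsqrtr // lerDl sqr_ge0. Qed.

Lemma Im_le_modc z : `|complex.Im z| <= modc z.
Proof. by rewrite modcE -sqrtr_sqr ler_wsqrtr // lerDr sqr_ge0. Qed.

Lemma modc_leD z : modc z <= `|complex.Re z| + `|complex.Im z|.
Proof.
rewrite -(@ler_pXn2r _ 2) ?nnegrE ?modc_ge0 ?addr_ge0 //.
rewrite sqr_modc sqrrD !real_normK ?num_real // -addrA lerD2l lerDr.
by rewrite mulrn_wge0 // mulr_ge0.
Qed.

Lemma ReD x y : complex.Re (x + y) = complex.Re x + complex.Re y.
Proof. by case: x; case: y. Qed.

Lemma ImD x y : complex.Im (x + y) = complex.Im x + complex.Im y.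
Proof. by case: x; case: y. Qed.

Lemma ReN x : complex.Re (- x) = - complex.Re x.
Proof. by case: x. Qed.

Lemma ImN x : complex.Im (- x) = - complex.Im x.
Proof. by case: x. Qed.

Lemma Re_i : complex.Re ('i%C : cplx R) = 0. Proof. by []. Qed.

Lemma Im_i : complex.Im ('i%C : cplx R) = 1. Proof. by []. Qed.

Lemma Im_0 : complex.Im (0 : cplx R) = 0. Proof. by []. Qed.

Lemma Re_ofrealM (r : R) x : complex.Re (ofreal r * x) = r * complex.Re x.
Proof. by case: x => u v /=; rewrite mul0r subr0. Qed.

Lemma Im_ofrealM (r : R) x : complex.Im (ofreal r * x) = r * complex.Im x.
Proof. by case: x => u v /=; rewrite mul0r addr0. Qed.

Lemma ImV x : complex.Im x^-1 = - complex.Im x / modc x ^+ 2.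
Proof. by rewrite sqr_modc; case: x => u v /=; rewrite mulNr. Qed.

Lemma ofrealB (r s : R) : ofreal (r - s) = ofreal r - ofreal s.
Proof. exact: rmorphB. Qed.

Lemma ofrealM (r s : R) : ofreal (r * s) = ofreal r * ofreal s.
Proof. exact: rmorphM. Qed.

Lemma ofrealV (r : R) : ofreal (r^-1) = (ofreal r)^-1.
Proof. exact: fmorphV. Qed.

End Modulus.

(** The window is -N <= k < N, since [Negz i] is -(i + 1).  Windows symmetric up
    to one term matter only where the two ends have to cancel each other. *)
Definition psum {V : zmodType} (f : int -> V) (N : nat) : V :=
  \sum_(i < N) (f (Posz i) + f (Negz i)).

Section PartialSums.

Lemma psumS (V : zmodType) (f : int -> V) N :
  psum f N.+1 = psum f N + (f (Posz N) + f (Negz N)).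
Proof. by rewrite /psum big_ord_recr. Qed.

Lemma eq_psum (V : zmodType) (f g : int -> V) N :
  f =1 g -> psum f N = psum g N.
Proof. by move=> fg; apply: eq_bigr => i _; rewrite !fg. Qed.

Lemma psumD (V : zmodType) (f g : int -> V) N :
  psum (fun k => f k + g k) N = psum f N + psum g N.
Proof. by rewrite -big_split; apply: eq_bigr => i _; rewrite addrACA. Qed.

Lemma psumN (V : zmodType) (f : int -> V) N :
  psum (fun k => - f k) N = - psum f N.
Proof. by rewrite -sumrN; apply: eq_bigr => i _; rewrite opprD. Qed.

Lemma psumB (V : zmodType) (f g : int -> V) N :
  psum (fun k => f k - g k) N = psum f N - psum g N.
Proof. by rewrite psumD psumN. Qed.

Lemma psumZ (V : nzRingType) (c : V) (f : int -> V) N :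
  psum (fun k => c * f k) N = c * psum f N.
Proof. by rewrite mulr_sumr; apply: eq_bigr => i _; rewrite mulrDr. Qed.

Lemma psum_eq0 (V : zmodType) (f : int -> V) N :
  (forall k, f k = 0) -> psum f N = 0.
Proof. by move=> f0; apply: big1 => i _; rewrite !f0 addr0. Qed.

Lemma psum_pt (V : zmodType) (n : int) (x : V) N :
  (`|n| < N)%N -> psum (fun k => if k == n then x else 0) N = x.
Proof.
move=> nN; have [m mN nm] : exists2 m : 'I_N, true & n = Posz m \/ n = Negz m.
  case: n nN => m mN; first by exists (Ordinal mN) => //; left.
  by exists (Ordinal (ltnW mN)) => //; right.
rewrite /psum (bigD1 m) //= [X in _ + X]big1 ?addr0 => [|i /negPf im].
  by case: nm => ->; rewrite eqxx ?addr0 ?add0r.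
case: nm => ->; have := im; rewrite -val_eqE /= => im'.
  by rewrite !ifN ?addr0 // eqz_nat im'.
by rewrite !ifN ?addr0 //; apply/negbT/eqP => -[] /eqP; rewrite im'.
Qed.

Variable R : realType.
Implicit Types f g : int -> R.

Lemma ler_psum f g N : (forall k, f k <= g k) -> psum f N <= psum g N.
Proof. by move=> fg; apply: ler_sum => i _; apply: lerD. Qed.

Lemma psum_ge0 f N : (forall k, 0 <= f k) -> 0 <= psum f N.
Proof. by move=> f0; apply: sumr_ge0 => i _; rewrite addr_ge0. Qed.

Lemma psum_nondecr f : (forall k, 0 <= f k) ->
  {homo psum f : n m / (n <= m)%N >-> n <= m}.
Proof.
move=> f0 n m /subnK <-; elim: (m - n)%N => // p IHp; rewrite addSn psumS.
by apply: le_trans IHp _; rewrite lerDl addr_ge0.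
Qed.

Lemma ler_psum_pt f n N : (forall k, 0 <= f k) -> (`|n| < N)%N -> f n <= psum f N.
Proof.
move=> f0 nN; rewrite -[leLHS](psum_pt (f n) nN).
by apply: ler_psum => k; case: eqP => [->|].
Qed.

Lemma psum_pt_le (n : int) (x : R) N : 0 <= x ->
  psum (fun k => if k == n then x else 0) N <= x.
Proof.
move=> x0; have [nN|Nn] := ltnP `|n| N; first by rewrite psum_pt.
rewrite -[leRHS](@psum_pt _ n x `|n|.+1) //.
apply: psum_nondecr; last exact: leqW.
by move=> k; case: eqP.
Qed.

Lemma ler_norm_psum f N : `|psum f N| <= psum (fun k => `|f k|) N.
Proof.
apply: le_trans (ler_norm_sum _ _ _) _.
by apply: ler_sum => i _; apply: ler_normD.
Qed.

Lemma ler_modc_psum (f : int -> cplx R) N :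
  modc (psum f N) <= psum (fun k => modc (f k)) N.
Proof.
elim: N => [|N IHN]; first by rewrite /psum !big_ord0 modc0.
rewrite !psumS; apply: le_trans (modcD _ _) _.
by rewrite lerD //; apply: modcD.
Qed.

Lemma ofreal_psum f N : ofreal (psum f N) = psum (fun k => ofreal (f k)) N.
Proof.
elim: N => [|N IHN]; first by rewrite /psum !big_ord0.
by rewrite !psumS -IHN -!(rmorphD (@real_complex R)).
Qed.

Lemma Re_psum (f : int -> cplx R) N :
  complex.Re (psum f N) = psum (fun k => complex.Re (f k)) N.
Proof.
elim: N => [|N IHN]; first by rewrite /psum !big_ord0.
by rewrite !psumS !ReD IHN.
Qed.

Lemma Im_psum (f : int -> cplx R) N :
  complex.Im (psum f N) = psum (fun k => complex.Im (f k)) N.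
Proof.
elim: N => [|N IHN]; first by rewrite /psum !big_ord0.
by rewrite !psumS !ImD IHN.
Qed.

End PartialSums.

(** Summing real and imaginary parts separately reduces convergence to the
    completeness of [R]. *)
Definition csum {R : realType} (f : int -> cplx R) : cplx R :=
  toC (limn (psum (fun k => complex.Re (f k))))
      (limn (psum (fun k => complex.Im (f k)))).

Definition summable {R : realType} (f : int -> cplx R) : Prop :=
  exists B : R, forall N, psum (fun k => modc (f k)) N <= B.

Section ComplexSeries.
Variable R : realType.
Implicit Types (f g : int -> cplx R).

Lemma cvg_psum (u : int -> R) (B : R) :
  (forall N, psum (fun k => `|u k|) N <= B) -> cvgn (psum u).
Proof.
move=> uB.
have -> : psum u = series (fun i => u (Posz i) + u (Negz i)).
  by apply/funext => N; rewrite /series /= big_mkord.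
apply: normed_cvg; apply: nondecreasing_is_cvgn.
  apply/nondecreasing_seqP => n.
  by rewrite /= /series /= !big_mkord big_ord_recr lerDl.
exists B => _ [N _ <-]; apply: le_trans (uB N).
rewrite /= /series /= big_mkord; apply: ler_sum => i _; exact: ler_normD.
Qed.

Lemma csum_cvg f : summable f -> forall e : R, 0 < e ->
  \forall N \near \oo, modc (csum f - psum f N) < e.
Proof.
move=> [B fB] e e0.
have cRe : cvgn (psum (fun k => complex.Re (f k))).
  apply: (@cvg_psum _ B) => N; apply: le_trans (fB N).
  by apply: ler_psum => k; apply: Re_le_modc.
have cIm : cvgn (psum (fun k => complex.Im (f k))).
  apply: (@cvg_psum _ B) => N; apply: le_trans (fB N).
  by apply: ler_psum => k; apply: Im_le_modc.
have e2 : 0 < e / 2 by rewrite divr_gt0.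
near=> N.
apply: le_lt_trans (modc_leD _) _.
rewrite ReD ImD ReN ImN Re_psum Im_psum /= [ltRHS](splitr e).
apply: ltrD.
  by near: N; move/cvgrPdist_lt: cRe; apply.
by near: N; move/cvgrPdist_lt: cIm; apply.
Unshelve. all: by end_near. Qed.

Lemma csum_uniq f (s : cplx R) : summable f ->
  (forall e : R, 0 < e -> \forall N \near \oo, modc (s - psum f N) < e) ->
  csum f = s.
Proof.
move=> fs Hs; apply/eqP; rewrite -subr_eq0 -modc_eq0 eq_le modc_ge0 andbT.
apply/ler_addgt0Pr => e e0; rewrite add0r.
have e2 : 0 < e / 2 by rewrite divr_gt0.
have [N [H1 H2]] : exists N, modc (csum f - psum f N) < e / 2 /\
    modc (s - psum f N) < e / 2.
  near \oo => N; exists N; split; near: N; [exact: csum_cvg | exact: Hs].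
have -> : csum f - s = (csum f - psum f N) - (s - psum f N) by ring.
apply: le_trans (modcD _ _) _; rewrite modcN (splitr e).
by apply: lerD; apply: ltW.
Unshelve. all: by end_near. Qed.

Lemma eq_csum f g : f =1 g -> csum f = csum g.
Proof. by move=> /funext ->. Qed.

Lemma summable_le f (u : int -> R) (B : R) : (forall k, modc (f k) <= u k) ->
  (forall N, psum u N <= B) -> summable f.
Proof.
by move=> fu uB; exists B => N; apply: le_trans (uB N); apply: ler_psum.
Qed.

Lemma summableD f g : summable f -> summable g ->
  summable (fun k => f k + g k).
Proof.
move=> [B fB] [C gC]; exists (B + C) => N.
apply: le_trans (lerD (fB N) (gC N)); rewrite -psumD.
by apply: ler_psum => k; apply: modcD.
Qed.

Lemma summableZ c f : summable f -> summable (fun k => c * f k).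
Proof.
move=> [B fB]; exists (modc c * B) => N.
under eq_psum do rewrite modcM.
by rewrite psumZ ler_wpM2l ?modc_ge0.
Qed.

Lemma summable_pt (n : int) (x : cplx R) :
  summable (fun k => if k == n then x else 0).
Proof.
exists (modc x) => N.
have -> : psum (fun k => modc (if k == n then x else 0)) N
  = psum (fun k => if k == n then modc x else 0) N.
  by apply: eq_psum => k; case: eqP => // _; rewrite modc0.
have [nN|Nn] := ltnP `|n| N; first by rewrite psum_pt.
rewrite -[leRHS](@psum_pt _ n (modc x) `|n|.+1) //.
apply: psum_nondecr; first by move=> k; case: eqP => // _; exact: modc_ge0.
exact: leqW.
Qed.

(** Two exceptional indices suffice: that of the pole which has been removed, and
    the index 0 at which the compensating terms are based. *)
Lemma summable_off2 (f : int -> cplx R) (u : int -> R) (n m : int) (B : R) :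
  (forall k, 0 <= u k) ->
  (forall k, k != n -> k != m -> modc (f k) <= u k) ->
  (forall N, psum u N <= B) -> summable f.
Proof.
move=> u0 fu uB.
apply: (@summable_le _ (fun k => u k + ((if k == n then modc (f n) else 0)
   + (if k == m then modc (f m) else 0))) (B + (modc (f n) + modc (f m)))).
  move=> k; have [->|kn] := eqVneq k n.
    rewrite addrCA lerDl addr_ge0 //; case: eqP => // _; exact: modc_ge0.
  have [->|km] := eqVneq k m; first by rewrite add0r lerDr.
  by rewrite !addr0; apply: fu.
by move=> N; rewrite !psumD !lerD // psum_pt_le // modc_ge0.
Qed.

Lemma csumD f g : summable f -> summable g ->
  csum (fun k => f k + g k) = csum f + csum g.
Proof.
move=> fs gs; apply: csum_uniq; first exact: summableD.
move=> e e0; have e2 : 0 < e / 2 by rewrite divr_gt0.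
near=> N; rewrite psumD.
have -> : csum f + csum g - (psum f N + psum g N) =
  (csum f - psum f N) + (csum g - psum g N) by ring.
apply: le_lt_trans (modcD _ _) _; rewrite (splitr e); apply: ltrD.
  by near: N; apply: csum_cvg.
by near: N; apply: csum_cvg.
Unshelve. all: by end_near. Qed.

Lemma csumZ c f : summable f -> csum (fun k => c * f k) = c * csum f.
Proof.
move=> fs; apply: csum_uniq; first exact: summableZ.
move=> e e0; have c1 : 0 < modc c + 1 by rewrite ltr_wpDl ?modc_ge0.
near=> N; rewrite psumZ -mulrBr modcM.
apply: (@le_lt_trans _ _ ((modc c + 1) * modc (csum f - psum f N))).
  by rewrite ler_wpM2r ?modc_ge0 // lerDl.
rewrite mulrC -ltr_pdivlMr //.
by near: N; apply: csum_cvg => //; rewrite divr_gt0.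
Unshelve. all: by end_near. Qed.

Lemma csumB f g : summable f -> summable g ->
  csum (fun k => f k - g k) = csum f - csum g.
Proof.
move=> fs gs.
rewrite -[- csum g]mulN1r -csumZ // -csumD //; last exact: summableZ.
by apply: eq_csum => k; rewrite mulN1r.
Qed.

Lemma csum_pt (n : int) (x : cplx R) :
  csum (fun k => if k == n then x else 0) = x.
Proof.
apply: csum_uniq; first exact: summable_pt.
move=> e e0; near=> N; rewrite psum_pt ?subrr ?modc0 //.
by near: N; exact: nbhs_infty_gt.
Unshelve. all: by end_near. Qed.

Lemma modc_csum_le_near f (B : R) : summable f ->
  (\forall N \near \oo, modc (psum f N) <= B) -> modc (csum f) <= B.
Proof.
move=> fs fB; apply/ler_addgt0Pr => e e0.
near \oo => N.
have -> : csum f = psum f N + (csum f - psum f N) by ring.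
apply: le_trans (modcD _ _) _; apply: lerD; first by near: N.
by apply: ltW; near: N; apply: csum_cvg.
Unshelve. all: by end_near. Qed.

Lemma modc_csum_le f (u : int -> R) (B : R) : (forall k, modc (f k) <= u k) ->
  (forall N, psum u N <= B) -> modc (csum f) <= B.
Proof.
move=> fu uB; apply: modc_csum_le_near; first exact: (summable_le fu uB).
near=> N; apply: le_trans (ler_modc_psum _ _) _.
by apply: le_trans (uB N); apply: ler_psum.
Unshelve. all: by end_near. Qed.

Lemma Im_csum_eq0 f : (forall k, complex.Im (f k) = 0) ->
  complex.Im (csum f) = 0.
Proof.
move=> f0; rewrite /csum /=.
have -> : psum (fun k => complex.Im (f k)) = cst 0.
  by apply/funext => N; apply: psum_eq0.
exact: lim_cst.
Qed.

Lemma Im_csum_ge f n : summable f -> (forall k, 0 <= complex.Im (f k)) ->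
  complex.Im (f n) <= complex.Im (csum f).
Proof.
move=> fs f0; apply/ler_addgt0Pr => e e0; near \oo => N.
have H : modc (csum f - psum f N) < e by near: N; apply: csum_cvg.
have nN : (`|n| < N)%N by near: N; exact: nbhs_infty_gt.
have := le_lt_trans (Im_le_modc _) H; rewrite ImD ImN Im_psum ltr_norml => /andP[h _].
have := @ler_psum_pt _ (fun k => complex.Im (f k)) n N f0 nN.
move: h; lra.
Unshelve. all: by end_near. Qed.

Lemma Re_csum_ge0 f : summable f -> (forall k, 0 <= complex.Re (f k)) ->
  0 <= complex.Re (csum f).
Proof.
move=> fs f0; apply/ler_addgt0Pr => e e0; near \oo => N.
have H : modc (csum f - psum f N) < e by near: N; apply: csum_cvg.
have := le_lt_trans (Re_le_modc _) H; rewrite ReD ReN Re_psum ltr_norml => /andP[h _].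
have := @psum_ge0 _ (fun k => complex.Re (f k)) N f0.
move: h; lra.
Unshelve. all: by end_near. Qed.

End ComplexSeries.

(** The [n] with this property indexes the only term of a partial fraction
    expansion that can be large near [x]. *)
Definition nearest {R : realType} (a : int -> R) (n : int) (x : R) : Prop :=
  forall k, `|x - a n| <= `|x - a k|.

Lemma nearest_dist (R : realType) (a : int -> R) n x k : nearest a n x -> `|a k - a n| <= 2 * `|a k - x|.
Proof.
move=> /(_ k) nx; have := ler_normD (a k - x) (x - a n); rewrite subrKA.
by move: nx; rewrite distrC [`|x - a k|]distrC; lra.
Qed.

(** * Complex differentiability *)

Section ComplexDerivatives.
Variable R : realType.
Implicit Types (f g : cplx R -> cplx R) (z : cplx R).

Lemma ltc_ofreal (x y : R) : (ofreal x < ofreal y) = (x < y).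
Proof. exact: ltcR. Qed.

Lemma lec_ofreal (x y : R) : (ofreal x <= ofreal y) = (x <= y).
Proof. exact: lecR. Qed.

Lemma ofreal_gt0E (e : cplx R) : 0 < e -> exists2 r : R, 0 < r & e = ofreal r.
Proof.
move=> e0; have eR : e \is Num.real by rewrite realE ltW.
exists (complex.Re e); last by rewrite /ofreal RRe_real.
by rewrite -ltc_ofreal /ofreal RRe_real.
Qed.

Lemma near_modcP z (P : set (cplx R)) :
  (\forall t \near z, P t) <->
  exists2 r : R, 0 < r & forall t, modc (t - z) < r -> P t.
Proof.
split=> [/nbhs_ballP[e /= /ofreal_gt0E[r r0 ->]] H|[r r0 H]].
  exists r => // t tr; apply: H.
  by rewrite /ball /= /ball_ normE ltc_ofreal modcB.
apply/nbhs_ballP; exists (ofreal r); first by rewrite /= (@ltc_ofreal 0).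
by move=> t; rewrite /ball /= /ball_ normE ltc_ofreal modcB; apply: H.
Qed.

(** Termwise differentiation of a series yields a quadratic remainder, which
    spares any discussion of uniform convergence. *)
Lemma is_derive_quad f z D (r K : R) : 0 < r ->
  (forall h, modc h < r -> modc (f (z + h) - f z - h * D) <= K * modc h ^+ 2) ->
  is_derive z 1 f D.
Proof.
move=> r0 fD.
have cvgD : h^-1 *: ((f \o shift z) (h *: 1) - f z) @[h --> 0^'] --> D.
  apply/cvgrPdist_lt => _ /ofreal_gt0E[e e0 ->].
  have K1 : 0 < `|K| + 1 by rewrite ltr_wpDl.
  have d0 : 0 < Num.min r (e / (`|K| + 1)) by rewrite lt_min r0 divr_gt0.
  near=> h.
  have h0 : h != 0 by near: h; exact: nbhs_dnbhs_neq.
  have : modc h < Num.min r (e / (`|K| + 1)).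
    rewrite -ltc_ofreal -normE; near: h; apply: dnbhs0_lt.
    by rewrite (@ltc_ofreal 0).
  rewrite lt_min => /andP[hr he].
  rewrite normE ltc_ofreal /= /shift /= /GRing.scale /= mulr1 [h + z]addrC.
  have -> : D - h^-1 * (f (z + h) - f z) = - h^-1 * (f (z + h) - f z - h * D).
    by field.
  rewrite modcM modcN modcV mulrC ltr_pdivrMr ?modc_gt0 //.
  apply: le_lt_trans (fD _ hr) _.
  rewrite expr2 mulrA ltr_pM2r ?modc_gt0 //.
  apply: (@le_lt_trans _ _ ((`|K| + 1) * modc h)).
    by rewrite ler_wpM2r ?modc_ge0 // (le_trans (ler_norm _)) // lerDl.
  by rewrite mulrC -ltr_pdivlMr.
apply: DeriveDef; first by apply/cvg_ex; exists D.
exact: (cvg_lim (@norm_hausdorff _ _) cvgD).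
Unshelve. all: by end_near. Qed.

Lemma derivable_cvg f z : derivable f z 1 -> {for z, continuous f}.
Proof. by move=> /derivable1_diffP /differentiable_continuous. Qed.

Lemma derivable_neq0_near f z : derivable f z 1 -> f z != 0 ->
  \forall t \near z, f t != 0.
Proof. by move=> /derivable_cvg fz f0; exact: cvgr_neq0 fz f0. Qed.

Lemma near_eq_analytic f g z : (\forall t \near z, f t = g t) ->
  analytic_at f z -> analytic_at g z.
Proof.
move=> /near_join fg; apply: filterS2 fg => t fg ft.
exact: near_eq_derivable ft.
Qed.

Lemma analyticV f z : analytic_at f z -> f z != 0 ->
  analytic_at (fun t => (f t)^-1) z.
Proof.
move=> fz f0; have fd : derivable f z 1 by exact: nbhs_singleton fz.
have := derivable_neq0_near fd f0.
by apply: filterS2 fz => t ft ft0; exact: (@derivableV (cplx R) (cplx R) f t 1).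
Qed.

Lemma derivable_mul f g z : derivable f z 1 -> derivable g z 1 ->
  derivable (f * g) z 1.
Proof. by move=> fz gz; exact: (@derivableM (cplx R) (cplx R) f g z 1 fz gz). Qed.

Lemma analyticM f g z : analytic_at f z -> analytic_at g z ->
  analytic_at (fun t => f t * g t) z.
Proof. move=> fz gz; apply: filterS (filterI fz gz) => t [ft gt].
exact: (derivable_mul ft gt).
Qed.

Lemma analyticD f g z : analytic_at f z -> analytic_at g z ->
  analytic_at (fun t => f t + g t) z.
Proof. move=> fz gz; apply: filterS (filterI fz gz) => t [ft gt].
exact: (@derivableD (cplx R) (cplx R) _ f g t 1 ft gt).
Qed.

Lemma analytic_cst (c : cplx R) z : analytic_at (fun=> c) z.
Proof. by near=> t; exact: derivable_cst. Unshelve. all: by end_near. Qed.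

Lemma analytic_id z : analytic_at (fun t => t) z.
Proof. by near=> t; exact: derivable_id. Unshelve. all: by end_near. Qed.

Lemma analyticX f n z : analytic_at f z -> analytic_at (fun t => f t ^+ n) z.
Proof.
move=> fz; elim: n => [|n IHn].
  by under eq_fun do rewrite expr0; exact: analytic_cst.
by under eq_fun do rewrite exprS; exact: analyticM.
Qed.

End ComplexDerivatives.

Section PartialFractions.
Variables (R : realType) (a : int -> R).

(** The constants [al] make a series convergent without affecting its
    derivatives. *)
Definition partial_fractions (al be : int -> cplx R) (k : int) (z : cplx R) :=
  al k + be k * (ofreal (a k) - z)^-1.

(** The second order remainder of 1 / (a - z) at increment h is
    h^2 / ((a - z - h) (a - z)^2).  As a - z - h is bounded below, the remainders
    add up to a multiple of h^2 as soon as |be_k| / |a_k - z|^2 is summable. *)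
Lemma is_derive_partial_fractions (al be : int -> cplx R) (z : cplx R) (r K : R) :
  0 < r ->
  summable (fun k => partial_fractions al be k z) ->
  (forall k, be k != 0 -> 2 * r <= modc (ofreal (a k) - z)) ->
  (forall N, psum (fun k => modc (be k) / modc (ofreal (a k) - z) ^+ 2) N <= K) ->
  is_derive z 1 (fun t => csum (fun k => partial_fractions al be k t))
    (csum (fun k => be k * (ofreal (a k) - z) ^- 2)).
Proof.
move=> r0 sz far bK; pose u k := ofreal (a k) - z.
have u_gt k : be k != 0 -> 0 < modc (u k).
  by move=> /far; apply: lt_le_trans; rewrite mulr_gt0.
have uh_ge h k : modc h < r -> be k != 0 -> modc (u k) / 2 <= modc (u k - h).
  move=> hr /far; rewrite -/(u k) => far_k.
  have := modcD (u k - h) h; rewrite subrK; move: hr far_k; lra.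
have sD : summable (fun k => be k * (u k) ^- 2).
  apply: (@summable_le _ _ _ K _ bK) => k.
  by rewrite modcM modcV modcX.
have sdiff h : modc h < r -> summable (fun k => be k * (u k - h)^-1 - be k * (u k)^-1).
  move=> hr; apply: (@summable_le _ _
      (fun k => 2 * modc h * (modc (be k) / modc (u k) ^+ 2)) (2 * modc h * K)).
    move=> k; have [->|b0] := eqVneq (be k) 0.
      by rewrite !mul0r subrr modc0 mul0r mulr0.
    have u0 := u_gt k b0; have uh := uh_ge h k hr b0.
    have uh0 : 0 < modc (u k - h) by apply: lt_le_trans uh; rewrite divr_gt0.
    have -> : be k * (u k - h)^-1 - be k * (u k)^-1 =
        be k * h * ((u k - h)^-1 * (u k)^-1).
      by field; rewrite -!modc_gt0 u0 uh0.
    rewrite !modcM !modcV.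
    have : (modc (u k - h))^-1 <= 2 * (modc (u k))^-1.
      by rewrite -[2]invrK -invfM lef_pV2 ?posrE ?mulr_gt0 ?invr_gt0 // mulrC.
    have -> : 2 * modc h * (modc (be k) / modc (u k) ^+ 2) =
      modc (be k) * modc h * (2 * (modc (u k))^-1 * (modc (u k))^-1).
      by field; rewrite gt_eqF.
    move=> le; rewrite ler_wpM2l ?mulr_ge0 ?modc_ge0 //.
    by rewrite ler_wpM2r // invr_ge0 modc_ge0.
  move=> N; rewrite psumZ ler_wpM2l // mulr_ge0 ?modc_ge0 //.
apply: (@is_derive_quad _ _ _ _ r (r^-1 * K)) => // h hr.
have -> : csum (fun k => partial_fractions al be k (z + h)) =
    csum (fun k => partial_fractions al be k z) +
    csum (fun k => be k * (u k - h)^-1 - be k * (u k)^-1).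
  rewrite -csumD //; last exact: sdiff.
  apply: eq_csum => k; rewrite /partial_fractions opprD addrA -/(u k).
  rewrite -/(u k); ring.
rewrite [X in X - _]addrAC subrr add0r -csumZ // -csumB; [|exact: sdiff|exact: summableZ].
apply: (@modc_csum_le _ _
    (fun k => r^-1 * modc h ^+ 2 * (modc (be k) / modc (u k) ^+ 2))).
  move=> k; have [->|b0] := eqVneq (be k) 0.
    by rewrite !mul0r subrr sub0r mulr0 oppr0 modc0 mul0r mulr0.
  have u0 := u_gt k b0; have uh := uh_ge h k hr b0.
  have uh0 : 0 < modc (u k - h) by apply: lt_le_trans uh; rewrite divr_gt0.
  have -> : be k * (u k - h)^-1 - be k * (u k)^-1 - h * (be k * u k ^- 2) =
      be k * h ^+ 2 * ((u k - h)^-1 * u k ^- 2).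
    by field; rewrite -!modc_gt0 u0 uh0.
  rewrite !modcM !modcV !modcX.
  have -> : r^-1 * modc h ^+ 2 * (modc (be k) / modc (u k) ^+ 2) =
    modc (be k) * modc h ^+ 2 * (r^-1 * modc (u k) ^- 2) by ring.
  rewrite ler_wpM2l ?mulr_ge0 ?exprn_ge0 ?modc_ge0 //.
  rewrite ler_wpM2r ?invr_ge0 ?exprn_ge0 ?modc_ge0 //.
  rewrite lef_pV2 ?posrE //; apply: le_trans uh.
  by have := far k b0; rewrite -/(u k); lra.
move=> N; rewrite psumZ [leRHS]mulrAC ler_wpM2l //.
by rewrite mulr_ge0 ?invr_ge0 ?exprn_ge0 ?modc_ge0 // ltW.
Qed.

End PartialFractions.

(** * The inner function attached to a discrete measure *)

Section RealInequalities.
Variable R : realType.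

Lemma ler_scaleV (c x y : R) : 0 < x -> 0 < y -> x <= c * y -> y^-1 <= c * x^-1.
Proof. by move=> x0 y0 xy; rewrite ler_pdivlMr // mulrC ler_pdivrMr. Qed.

Lemma ler_prod_sqr (x y : R) : x * y <= x ^+ 2 + y ^+ 2.
Proof. have := sqr_ge0 (x - y); have := sqr_ge0 (x + y); nra. Qed.

(** The left side over the sum of squares is half of the modulus of the derivative
    of the inner function at distance [t] from a pole of weight [v], when the rest
    of the Herglotz function has value [g0] and slope [gam] there.  If t g0 is at
    most v / 2, then the first square is at least v^2 / 4, and [v] being bounded
    below concludes; otherwise v < 4 K' t^2 because g0^2 <= K' v. *)
Lemma derive_bound (c K' G' t g0 v gam : R) : 0 < c -> c <= v ->
  0 <= gam <= G' -> 0 <= K' -> g0 ^+ 2 <= K' * v ->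
  v + t ^+ 2 * gam <= (4 / c + 4 * K' + G') * ((t * g0 - v) ^+ 2 + t ^+ 2).
Proof.
move=> c0 cv /andP[gam0 gamG] K0 gK; set Q := (X in _ <= _ * X).
have v0 : 0 < v by lra.
have tQ : t ^+ 2 <= Q by rewrite /Q lerDr sqr_ge0.
have Q0 : 0 <= Q by apply: le_trans tQ; exact: sqr_ge0.
have h1 : t ^+ 2 * gam <= G' * Q.
  rewrite mulrC; apply: ler_pM => //; exact: sqr_ge0.
suff h2 : v <= (4 / c + 4 * K') * Q by rewrite mulrDl lerD.
have ci : 0 < c^-1 by rewrite invr_gt0.
have [tg|tg] := leP (t * g0) (v / 2).
  apply: (@le_trans _ _ (4 / c * Q)); last first.
    by rewrite ler_wpM2r // lerDl mulr_ge0.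
  have qv : v ^+ 2 <= 4 * Q by rewrite /Q; have := sqr_ge0 t; nra.
  rewrite mulrAC ler_pdivlMr //; nra.
apply: (@le_trans _ _ (4 * K' * Q)); last first.
  by rewrite ler_wpM2r // lerDr divr_ge0 // ltW.
have : v ^+ 2 < 4 * (t ^+ 2 * g0 ^+ 2) by rewrite -exprMn; nra.
have : t ^+ 2 * g0 ^+ 2 <= t ^+ 2 * (K' * v) by rewrite ler_wpM2l ?sqr_ge0.
have : K' * t ^+ 2 <= K' * Q by rewrite ler_wpM2l.
nra.
Qed.

End RealInequalities.

Section InnerFromWeights.
Variables (R : realType) (a w : int -> R) (delta K : R).
Hypothesis delta_gt0 : 0 < delta.
Hypothesis a_sep : forall n m : int, n != m -> delta < `|a n - a m|.
Hypothesis a_nearest : forall x, exists n, nearest a n x.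
Hypothesis w_gt0 : forall k, 0 < w k.
Hypothesis w_sum : forall n N, psum (fun k => w k / (a k - a n) ^+ 2) N <= K.
Implicit Types (z : cplx R) (n k : int).

Let w_ge0 k : 0 <= w k. Proof. exact: ltW. Qed.

Let K_ge0 : 0 <= K.
Proof.
apply: le_trans (w_sum 0 0); apply: psum_ge0 => k.
by rewrite divr_ge0 ?sqr_ge0 // ltW.
Qed.

(** Around such a [z] the distances from the other poles are controlled by the
    distances between poles, so that sums over k <> n are bounded by sums which do
    not involve [z].  The constant leaves room for a whole neighbourhood of a point
    whose real part is nearest to [a n]. *)
Definition isolates n z : Prop :=
  forall k, k != n -> `|a k - a n| <= 4 * modc (ofreal (a k) - z).

Lemma dist_gt0 n k : k != n -> 0 < `|a k - a n|.
Proof. by move=> /a_sep; apply: lt_trans. Qed.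

Lemma isolates_gt0 n z k : isolates n z -> k != n -> 0 < modc (ofreal (a k) - z).
Proof.
move=> /(_ k) iso kn; have := iso kn; have := dist_gt0 kn; lra.
Qed.

Lemma isolates_ge n z k : isolates n z -> k != n ->
  delta / 4 <= modc (ofreal (a k) - z).
Proof.
move=> /(_ k) iso kn; have := iso kn; have := a_sep kn; lra.
Qed.

Lemma nearest_isolates n z t : nearest a n (complex.Re z) ->
  modc (t - z) < delta / 4 -> isolates n t.
Proof.
move=> nz tz k kn; have := nearest_dist k nz; have := a_sep kn.
have := Re_le_modc (ofreal (a k) - z); rewrite ReD ReN /=.
have := modcD (ofreal (a k) - t) (t - z); rewrite subrKA.
by move: tz; lra.
Qed.

Lemma near_isolates n z : nearest a n (complex.Re z) -> \forall t \near z, isolates n t.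
Proof.
move=> nz; apply/near_modcP; exists (delta / 4); first by rewrite divr_gt0.
by move=> t; apply: nearest_isolates.
Qed.

Lemma isolates_self n z : nearest a n (complex.Re z) -> isolates n z.
Proof.
by move=> nz; apply: (nearest_isolates nz); rewrite subrr modc0 divr_gt0.
Qed.

Lemma isolates_near_pole n z : modc (z - ofreal (a n)) <= delta / 2 -> isolates n z.
Proof.
move=> zn k kn; have := a_sep kn.
have := modcD (ofreal (a k) - z) (z - ofreal (a n)).
by rewrite subrKA -ofrealB modc_ofreal; move: zn delta_gt0; lra.
Qed.

Lemma isolates_sum n z N : isolates n z ->
  psum (fun k => (if k == n then 0 else w k) / modc (ofreal (a k) - z) ^+ 2) N
  <= 16 * K.
Proof.
move=> iso; apply: (@le_trans _ _ (psum (fun k => 16 * (w k / (a k - a n) ^+ 2)) N)).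
  apply: ler_psum => k; have [->|kn] := eqVneq k n.
    by rewrite mul0r subrr expr0n /= invr0 !mulr0.
  have d0 := dist_gt0 kn; have m0 := isolates_gt0 iso kn.
  rewrite mulrCA ler_wpM2l ?w_ge0 // -[(a k - a n) ^+ 2]real_normK ?num_real //.
  apply: ler_scaleV; rewrite ?exprn_gt0 //.
  by rewrite (_ : 16 = 4 ^+ 2) -?exprMn ?lerXn2r ?nnegrE ?mulr_ge0 ?modc_ge0 ?iso //;
    ring.
by rewrite psumZ ler_wpM2l.
Qed.

Lemma offpole_sum z : (forall k, z != ofreal (a k)) ->
  exists B, forall N, psum (fun k => w k / modc (ofreal (a k) - z) ^+ 2) N <= B.
Proof.
move=> zP; have [n nz] := a_nearest (complex.Re z).
exists (16 * K + w n / modc (ofreal (a n) - z) ^+ 2) => N.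
have x0 : 0 <= w n / modc (ofreal (a n) - z) ^+ 2.
  by rewrite divr_ge0 ?exprn_ge0 ?modc_ge0 // ltW.
apply: le_trans (lerD (isolates_sum N (isolates_self nz)) (psum_pt_le n N x0)).
rewrite -psumD; apply: ler_psum => k.
by case: eqP => [->|_]; rewrite ?mul0r ?add0r ?addr0.
Qed.

Lemma offpole_gt0 z k : (forall k, z != ofreal (a k)) -> 0 < modc (ofreal (a k) - z).
Proof. by move=> /(_ k) zk; rewrite modc_gt0 subr_eq0 eq_sym. Qed.

(** By the inequality of arithmetic and geometric means, any two points off the
    poles can be combined. *)
Lemma offpole_prod z z' : (forall k, z != ofreal (a k)) ->
  (forall k, z' != ofreal (a k)) -> exists B, forall N,
  psum (fun k => w k / (modc (ofreal (a k) - z) * modc (ofreal (a k) - z'))) N <= B.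
Proof.
move=> /offpole_sum[B HB] /offpole_sum[B' HB']; exists (B + B') => N.
apply: le_trans (lerD (HB N) (HB' N)); rewrite -psumD; apply: ler_psum => k.
rewrite -mulrDr ler_wpM2l ?w_ge0 // -!exprVn invfM; exact: ler_prod_sqr.
Qed.

(** The compensating terms are values of the same fractions at [a 0]; at k = 0 the
    convention 1 / 0 = 0 makes the compensating term vanish. *)
Definition herglotz (z : cplx R) : cplx R :=
  csum (fun k => ofreal (w k) * ((ofreal (a k) - z)^-1 - (ofreal (a k) - ofreal (a 0))^-1)).

Definition regular_term n k z : cplx R :=
  ofreal (w k) * ((if k == n then 0 else (ofreal (a k) - z)^-1)
    - (ofreal (a k) - ofreal (a 0))^-1).

Definition regular_part n z : cplx R := csum (fun k => regular_term n k z).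

Lemma regular_summable n z : isolates n z -> summable (fun k => regular_term n k z).
Proof.
move=> iso; pose M := 4 * modc (z - ofreal (a 0)).
have M0 : 0 <= M by rewrite mulr_ge0 ?modc_ge0.
apply: (@summable_off2 _ _
    (fun k => M * (w k / (a k - a n) ^+ 2 + w k / (a k - a 0) ^+ 2)) n 0
    (M * (K + K))).
- by move=> k; rewrite mulr_ge0 // addr_ge0 // divr_ge0 ?sqr_ge0 // ltW.
- move=> k kn k0; rewrite /regular_term (negPf kn).
  have d0 := dist_gt0 kn; have d1 := dist_gt0 k0; have m0 := isolates_gt0 iso kn.
  have e1 : ofreal (a k) - ofreal (a 0) != 0 by rewrite -modc_gt0 -ofrealB modc_ofreal.
  have e2 : ofreal (a k) - z != 0 by rewrite -modc_gt0.
  have -> : (ofreal (a k) - z)^-1 - (ofreal (a k) - ofreal (a 0))^-1 =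
    (z - ofreal (a 0)) * ((ofreal (a k) - z)^-1 * (ofreal (a k) - ofreal (a 0))^-1).
    by field; rewrite e1 e2.
  rewrite !modcM !modcV modc_ofreal gtr0_norm // -ofrealB modc_ofreal.
  have h1 : (modc (ofreal (a k) - z))^-1 <= 4 * `|a k - a n|^-1.
    by apply: ler_scaleV => //; apply: iso.
  have h2 := ler_prod_sqr (`|a k - a n|^-1) (`|a k - a 0|^-1).
  rewrite !exprVn !real_normK ?num_real // in h2.
  rewrite -mulrDr [M * _]mulrCA ler_wpM2l ?w_ge0 // /M [4 * _]mulrC -mulrA.
  rewrite ler_wpM2l ?modc_ge0 //.
  apply: (@le_trans _ _ (4 * `|a k - a n|^-1 * `|a k - a 0|^-1)).
    by rewrite ler_wpM2r // invr_ge0.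
  by rewrite -mulrA ler_wpM2l.
- by move=> N; rewrite psumZ psumD ler_wpM2l // lerD.
Qed.

Lemma herglotzE n z : isolates n z -> z != ofreal (a n) ->
  herglotz z = regular_part n z + ofreal (w n) * (ofreal (a n) - z)^-1.
Proof.
move=> iso zn; rewrite -(csum_pt n (ofreal (w n) * _)) -csumD.
- apply: eq_csum => k; rewrite /regular_term; case: eqP => [->|_].
    by rewrite sub0r mulrN mulrBr addrC.
  by rewrite addr0.
- exact: regular_summable.
- exact: summable_pt.
Qed.

Lemma herglotz_summable z : (forall k, z != ofreal (a k)) -> summable
  (fun k => ofreal (w k) * ((ofreal (a k) - z)^-1 - (ofreal (a k) - ofreal (a 0))^-1)).
Proof.
move=> zP; have [n nz] := a_nearest (complex.Re z).
have := summableD (regular_summable (isolates_self nz))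
  (summable_pt n (ofreal (w n) * (ofreal (a n) - z)^-1)).
congr summable; apply/funext => k; rewrite /regular_term; case: eqP => [->|_].
  by rewrite sub0r mulrN mulrBr addrC.
by rewrite addr0.
Qed.

Lemma regular_derive n z : isolates n z ->
  is_derive z 1 (regular_part n)
    (csum (fun k => (if k == n then 0 else ofreal (w k)) * (ofreal (a k) - z) ^- 2)).
Proof.
move=> iso.
pose al k := - (ofreal (w k) * (ofreal (a k) - ofreal (a 0))^-1).
pose be k := if k == n then 0 else ofreal (w k).
have e t : (fun k => regular_term n k t) =1 (fun k => partial_fractions a al be k t).
  move=> k; rewrite /regular_term /partial_fractions /al /be mulrBr addrC.
  by case: eqP => _; rewrite ?mulr0 ?mul0r.
have -> : regular_part n = (fun t => csum (fun k => partial_fractions a al be k t)).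
  by apply/funext => t; apply: eq_csum; apply: e.
apply: (@is_derive_partial_fractions _ _ _ _ _ (delta / 8) (16 * K)).
- by rewrite divr_gt0.
- rewrite -(_ : (fun k => regular_term n k z) = fun k => partial_fractions a al be k z).
    exact: regular_summable.
  by apply/funext.
- move=> k; rewrite /be; have [_|kn _] := eqVneq k n; first by rewrite eqxx.
  by have := isolates_ge iso kn; move: delta_gt0; lra.
- move=> N; apply: le_trans (isolates_sum N iso); apply: ler_psum => k.
  by rewrite /be; case: eqP => _; rewrite ?modc0 // modc_ofreal gtr0_norm.
Qed.

(** Each fraction 1 / (a_k - z) maps the upper half-plane to itself. *)
Lemma herglotz_Im_gt0 z : 0 < complex.Im z -> 0 < complex.Im (herglotz z).
Proof.
move=> z0; have zP k : z != ofreal (a k).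
  by apply/eqP => zk; move: z0; rewrite zk /= ltxx.
have ImE k : complex.Im (ofreal (w k) *
   ((ofreal (a k) - z)^-1 - (ofreal (a k) - ofreal (a 0))^-1)) =
   w k * (complex.Im z / modc (ofreal (a k) - z) ^+ 2).
  rewrite Im_ofrealM -ofrealB -ofrealV ImD ImN ImV ImD ImN /= oppr0 addr0.
  by rewrite add0r opprK.
have Im_gt0 k : 0 < w k * (complex.Im z / modc (ofreal (a k) - z) ^+ 2).
  by rewrite mulr_gt0 // divr_gt0 // exprn_gt0 // offpole_gt0.
apply: lt_le_trans (Im_csum_ge 0 (herglotz_summable zP) _).
  by rewrite ImE.
by move=> k; rewrite ImE ltW.
Qed.

(** This is (z - a_n) (H(z) + i), where H is the Herglotz function, continued
    across its pole a_n. *)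
Definition denom n z : cplx R :=
  - ofreal (w n) + (z - ofreal (a n)) * (regular_part n z + 'i%C).

Lemma denomE n z : isolates n z -> z != ofreal (a n) ->
  denom n z = (z - ofreal (a n)) * (herglotz z + 'i%C).
Proof.
move=> iso zn; rewrite (herglotzE iso zn) /denom.
by field; rewrite subr_eq0 eq_sym.
Qed.

Lemma regular_real n (x : R) : complex.Im (regular_part n (ofreal x)) = 0.
Proof.
apply: Im_csum_eq0 => k; rewrite /regular_term Im_ofrealM -!ofrealB -!ofrealV.
by case: eqP => _; rewrite ImD ImN /= ?oppr0 addr0 mulr0.
Qed.

(** Above the real line the imaginary part of H + i exceeds 1.  On the real line the
    regular part is real, so the imaginary part of the denominator is x - a_n, and
    at a_n the denominator is - w_n. *)
Lemma denom_neq0 n z : isolates n z -> 0 <= complex.Im z -> denom n z != 0.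
Proof.
move=> iso; rewrite le_eqVlt => /orP[/eqP z0|z0].
  have -> : z = ofreal (complex.Re z).
    by move: z0; case: (z) => x y /= <-.
  set x := complex.Re z; have := regular_real n x.
  rewrite /denom; case: (regular_part n (ofreal x)) => u v /= ->.
  rewrite eq_complex /= negb_and.
  have [->|xn] := eqVneq x (a n).
    by rewrite !(subrr, mul0r, mulr0, addr0, oppr0) oppr_eq0 gt_eqF.
  apply/orP; right; rewrite !(oppr0, addr0, add0r, mul0r, mulr1) subr_eq0.
  by [].
have zn : z != ofreal (a n) by apply/eqP => zk; move: z0; rewrite zk /= ltxx.
rewrite denomE // mulf_neq0 ?subr_eq0 //.
apply/eqP => /(congr1 (@complex.Im R)); rewrite ImD Im_i Im_0 => h.
by have := herglotz_Im_gt0 z0; move: h; lra.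
Qed.

(** This is (H - i) / (H + i), with H the Herglotz function; the value 1 is the limit
    at a pole of H. *)
Definition theta (z : cplx R) : cplx R :=
  if `[< exists k, z = ofreal (a k) >] then 1
  else 1 - 2 * 'i%C / (herglotz z + 'i%C).

(** A single expression holds on a full neighbourhood of any point, whether or not
    it is a pole of the Herglotz function: analyticity and the derivative are read
    off from it. *)
Lemma thetaE n z : isolates n z ->
  theta z = 1 - 2 * 'i%C * (z - ofreal (a n)) * (denom n z)^-1.
Proof.
move=> iso; rewrite /theta; case: asboolP => [[k zk]|nz].
  have [kn|kn] := eqVneq k n; first by rewrite zk kn subrr mulr0 mul0r subr0.
  by have := isolates_gt0 iso kn; rewrite zk subrr modc0 ltxx.
have zn : z != ofreal (a n) by apply/eqP => zn; apply: nz; exists n.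
rewrite denomE // invfM -!mulrA; congr (1 - 2 * ('i%C * _)).
by rewrite mulrA divff ?mul1r // subr_eq0.
Qed.

Lemma regular_analytic n z : nearest a n (complex.Re z) ->
  analytic_at (regular_part n) z.
Proof.
move=> /near_isolates; apply: filterS => t /regular_derive h; exact: ex_derive.
Qed.

Lemma denom_analytic n z : nearest a n (complex.Re z) -> analytic_at (denom n) z.
Proof.
move=> nz; apply: analyticD; first exact: analytic_cst.
apply: analyticM; first by apply: analyticD; [exact: analytic_id|exact: analytic_cst].
by apply: analyticD; [exact: regular_analytic|exact: analytic_cst].
Qed.

Lemma theta_analytic n z : nearest a n (complex.Re z) -> denom n z != 0 ->
  analytic_at theta z.
Proof.
move=> nz d0.
apply: (@near_eq_analytic _
  (fun t => 1 + (- (2 * 'i%C)) * ((t - ofreal (a n)) * (denom n t)^-1))).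
  apply: filterS (near_isolates nz) => t /thetaE ->.
  by rewrite mulNr !mulrA.
apply: analyticD; first exact: analytic_cst.
apply: analyticM; first exact: analytic_cst.
apply: analyticM; first by apply: analyticD; [exact: analytic_id|exact: analytic_cst].
by apply: analyticV => //; exact: denom_analytic.
Qed.

Lemma theta_analytic_Im z : 0 <= complex.Im z -> analytic_at theta z.
Proof.
move=> z0; have [n nz] := a_nearest (complex.Re z).
by apply: (theta_analytic nz); apply: denom_neq0 => //; apply: isolates_self.
Qed.

Lemma theta_le1 z : upper_half_plane z -> `|theta z| <= ofreal 1.
Proof.
move=> z0; rewrite normE lec_ofreal /theta.
case: asboolP => [_|_]; first by rewrite modc1.
have H0 := herglotz_Im_gt0 z0.
have D0 : 0 < modc (herglotz z + 'i%C).
  rewrite modc_gt0; apply/eqP => /(congr1 (@complex.Im R)).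
  by rewrite ImD Im_i Im_0; move: H0; lra.
have -> : 1 - 2 * 'i%C / (herglotz z + 'i%C) =
    (herglotz z - 'i%C) / (herglotz z + 'i%C).
  by field; rewrite -modc_gt0.
rewrite modcM modcV ler_pdivrMr // mul1r.
rewrite -(@ler_pXn2r _ 2) ?nnegrE ?modc_ge0 // !sqr_modc !ReD !ImD ReN ImN Re_i Im_i.
rewrite oppr0 lerD2l; move: H0; nra.
Qed.

Lemma theta_unimodular (x : R) : `|theta (ofreal x)| = 1.
Proof.
rewrite normE /theta; case: asboolP => [_|xP]; first by rewrite modc1.
have zP k : ofreal x != ofreal (a k) by apply/eqP => e; apply: xP; exists k.
have [n nx] := a_nearest x.
have iso : isolates n (ofreal x) by apply: isolates_self.
have HI : complex.Im (herglotz (ofreal x)) = 0.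
  rewrite (herglotzE iso (zP n)) ImD regular_real -ofrealB -ofrealV.
  by rewrite Im_ofrealM /= mulr0 addr0.
have D0 : 0 < modc (herglotz (ofreal x) + 'i%C).
  rewrite modc_gt0; apply/eqP => /(congr1 (@complex.Im R)).
  by rewrite ImD HI Im_i Im_0; lra.
have -> : 1 - 2 * 'i%C / (herglotz (ofreal x) + 'i%C) =
    (herglotz (ofreal x) - 'i%C) / (herglotz (ofreal x) + 'i%C).
  by field; rewrite -modc_gt0.
rewrite modcM modcV [X in X / _](_ : _ = modc (herglotz (ofreal x) + 'i%C)).
  by rewrite divff // gt_eqF.
by rewrite !modcE !ReD !ImD ReN ImN HI Re_i Im_i oppr0 sub0r add0r sqrrN.
Qed.

Lemma theta_inner : inner_function theta.
Proof.
split.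
- by move=> z z0; apply: theta_analytic_Im; apply: ltW.
- by exists 1 => z; apply: theta_le1.
- apply: aeW => x; exists (theta (ofreal x)); last exact: theta_unimodular.
  have /nbhs_singleton/derivable_cvg ct : analytic_at theta (ofreal x).
    by apply: theta_analytic_Im.
  suff vert : toC x y @[y --> 0^'+] --> ofreal x by exact: (cvg_comp _ _ vert ct).
  move=> P /near_modcP[r r0 HP]; change (\forall y \near 0^'+, P (toC x y)).
  near=> y; apply: HP.
  have -> : toC x y - ofreal x = toC 0 y.
    by rewrite /toC /ofreal; apply/eqP; rewrite eq_complex /= subrr subr0 !eqxx.
  have y0 : 0 < y by near: y; exact: nbhs_right_gt.
  have yr : y < r by near: y; exact: nbhs_right_lt.
  by rewrite modcE /= expr0n /= add0r sqrtr_sqr gtr0_norm.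
Unshelve. all: by end_near. Qed.

Lemma theta_spectrum : spectrum theta = range a.
Proof.
rewrite eqEsubset; split => [x|_ [k _ <-]]; rewrite /spectrum /= /theta; last first.
  by case: asboolP => // h; exfalso; apply: h; exists k.
case: asboolP => [[k [->]] _|_]; first by exists k.
have [n nx] := a_nearest x.
have iso : isolates n (ofreal x) by apply: isolates_self.
have [->|xn] := eqVneq x (a n); first by exists n.
have zn : ofreal x != ofreal (a n) by apply/eqP => -[e]; rewrite e eqxx in xn.
have : denom n (ofreal x) != 0 by apply: denom_neq0.
rewrite (denomE iso zn) mulf_eq0 negb_or => /andP[_ d0] /eqP.
rewrite -subr_eq0 addrAC subrr add0r oppr_eq0 !mulf_eq0 invr_eq0 (negPf d0) orbF.
have i0 : ('i%C : cplx R) != 0 by rewrite -modc_gt0 modc_i ltr01.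
by rewrite pnatr_eq0 (negPf i0).
Qed.

(** * Zeros of the denominator and poles of the inner function *)

(** Iterating 1 / (a - z) - 1 / (a - p) = (z - p) / ((a - p) (a - z)) expands the
    Herglotz function at a nonreal point [p].  The j-th remainder is again a series
    of partial fractions, and its value at [p] is the coefficient of order j + 1. *)
Definition taylor_term p j k z : cplx R :=
  ofreal (w k) * (ofreal (a k) - p)^-1 ^+ j.+1 * (ofreal (a k) - z)^-1.

Definition taylor_rem p j z : cplx R := csum (fun k => taylor_term p j k z).

Lemma nearest_modc n z k : nearest a n (complex.Re z) ->
  modc (ofreal (a n) - z) <= modc (ofreal (a k) - z).
Proof.
move=> /(_ k) nz; rewrite -(@ler_pXn2r _ 2) ?nnegrE ?modc_ge0 // !sqr_modc.
rewrite !ReD !ImD !ReN !ImN /= lerD2r -[leLHS]sqrrN -[leRHS]sqrrN !opprB.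
by rewrite -(real_normK (num_real (_ - a n))) -(real_normK (num_real (_ - a k)))
  ler_pXn2r ?nnegrE.
Qed.

Lemma offpole_Im z : complex.Im z != 0 -> forall k, z != ofreal (a k).
Proof. by move=> z0 k; apply: contra_neq z0 => ->. Qed.

Lemma taylor_modc p j z k (rho : R) : 0 < rho ->
  (forall k, rho <= modc (ofreal (a k) - p)) ->
  modc (taylor_term p j k z) <=
  rho ^- j * (w k / (modc (ofreal (a k) - p) * modc (ofreal (a k) - z))).
Proof.
move=> rho0 rhoP.
rewrite /taylor_term !modcM modcX !modcV modc_ofreal gtr0_norm //.
set V := (modc (ofreal (a k) - p))^-1; set Z := (modc (ofreal (a k) - z))^-1.
have -> : w k * V ^+ j.+1 * Z = w k * (V * Z) * V ^+ j by rewrite exprS; ring.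
rewrite invfM -/V -/Z [leRHS]mulrC ler_wpM2l ?mulr_ge0 ?invr_ge0 ?modc_ge0 //.
rewrite -exprVn lerXn2r ?nnegrE ?invr_ge0 ?modc_ge0 //.
  exact: ltW.
by rewrite lef_pV2 ?posrE //; apply: lt_le_trans (rhoP k).
Qed.

Lemma offpole_rho p : (forall k, p != ofreal (a k)) ->
  exists2 rho : R, 0 < rho & forall k, rho <= modc (ofreal (a k) - p).
Proof.
move=> pP; have [n np] := a_nearest (complex.Re p).
by exists (modc (ofreal (a n) - p)) => [|k]; [exact: offpole_gt0|exact: nearest_modc].
Qed.

Lemma taylor_summable p j z : (forall k, p != ofreal (a k)) ->
  (forall k, z != ofreal (a k)) -> summable (fun k => taylor_term p j k z).
Proof.
move=> pP zP; have [rho rho0 rhoP] := offpole_rho pP.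
have [B HB] := offpole_prod pP zP.
apply: (@summable_le _ _ _ (rho ^- j * B) (fun k => taylor_modc j z k rho0 rhoP)).
by move=> N; rewrite psumZ ler_wpM2l // invr_ge0 exprn_ge0 // ltW.
Qed.

Lemma herglotz_taylor0 p z : (forall k, p != ofreal (a k)) ->
  (forall k, z != ofreal (a k)) ->
  herglotz z - herglotz p = (z - p) * taylor_rem p 0 z.
Proof.
move=> pP zP; rewrite -csumZ; last exact: taylor_summable.
rewrite -csumB; [|exact: herglotz_summable|exact: herglotz_summable].
apply: eq_csum => k; rewrite /taylor_term expr1.
set c := (ofreal (a k) - ofreal (a 0))^-1.
by field; rewrite -!modc_gt0 !offpole_gt0.
Qed.

Lemma taylor_step p j z : (forall k, p != ofreal (a k)) ->
  (forall k, z != ofreal (a k)) ->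
  taylor_rem p j z - taylor_rem p j p = (z - p) * taylor_rem p j.+1 z.
Proof.
move=> pP zP; rewrite -csumZ; last exact: taylor_summable.
rewrite -csumB; [|exact: taylor_summable|exact: taylor_summable].
apply: eq_csum => k; rewrite /taylor_term [_ ^+ j.+2]exprSr.
set c := _ ^+ j.+1.
by field; rewrite -!modc_gt0 !offpole_gt0.
Qed.

Lemma taylor_vanish p j z : (forall k, p != ofreal (a k)) ->
  (forall k, z != ofreal (a k)) ->
  (forall i, (i < j)%N -> taylor_rem p i p = 0) ->
  herglotz z - herglotz p = (z - p) ^+ j.+1 * taylor_rem p j z.
Proof.
move=> pP zP; elim: j => [_|j IHj van]; first by rewrite expr1 herglotz_taylor0.
rewrite IHj => [|i ij]; last by apply: van; exact: ltnW.
by rewrite [in RHS]exprSr -mulrA -taylor_step // van // subr0.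
Qed.

Lemma taylor_analytic p j z : (forall k, p != ofreal (a k)) ->
  complex.Im z != 0 -> analytic_at (taylor_rem p j) z.
Proof.
move=> pP z0; have [rho rho0 rhoP] := offpole_rho pP.
suff derT t : complex.Im t != 0 -> derivable (taylor_rem p j) t 1.
  apply/near_modcP; exists `|complex.Im z|; first by rewrite normr_gt0.
  move=> t tz; apply: derT; apply/eqP => t0.
  by have := le_lt_trans (Im_le_modc _) tz; rewrite ImD ImN t0 sub0r normrN ltxx.
move=> t0; have tP := offpole_Im t0; have [B HB] := offpole_sum tP.
pose be k := ofreal (w k) * (ofreal (a k) - p)^-1 ^+ j.+1.
have e s : (fun k => taylor_term p j k s) =1 (fun k => partial_fractions a (fun=> 0) be k s).
  by move=> k; rewrite /partial_fractions add0r.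
have -> : taylor_rem p j = (fun t => csum (fun k => partial_fractions a (fun=> 0) be k t)).
  by apply/funext => s; apply: eq_csum; apply: e.
apply: (@ex_derive _ _ _ _ _ _ (csum (fun k => be k * (ofreal (a k) - t) ^- 2))).
apply: (@is_derive_partial_fractions _ _ _ _ _ (`|complex.Im t| / 2) (rho ^- j.+1 * B)).
- by rewrite divr_gt0 // normr_gt0.
- rewrite -(_ : (fun k => taylor_term p j k t) = fun k => partial_fractions a (fun=> 0) be k t).
    exact: taylor_summable.
  by apply/funext; exact: e.
- move=> k _; have := Im_le_modc (ofreal (a k) - t).
  by rewrite ImD ImN /= add0r normrN; lra.
- move=> N; apply: (@le_trans _ _ (psum (fun k => rho ^- j.+1 *
     (w k / modc (ofreal (a k) - t) ^+ 2)) N)); last first.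
    by rewrite psumZ ler_wpM2l // invr_ge0 exprn_ge0 // ltW.
  apply: ler_psum => k; rewrite /be modcM modcX modcV modc_ofreal gtr0_norm //.
  rewrite mulrA ler_wpM2r ?invr_ge0 ?exprn_ge0 ?modc_ge0 // mulrC.
  rewrite ler_wpM2r ?w_ge0 // -exprVn lerXn2r ?nnegrE ?invr_ge0 ?modc_ge0 //.
    exact: ltW.
  by rewrite lef_pV2 ?posrE //; apply: lt_le_trans (rhoP k).
Qed.

Lemma ImB_seg p n (s : R) :
  complex.Im (p + ofreal s * (ofreal (a n) - p)) = (1 - s) * complex.Im p.
Proof. rewrite ImD Im_ofrealM ImD ImN /=; ring. Qed.

(** If all coefficients vanish, H(z) - H(p) is (z - p)^(j+1) times the j-th
    remainder for every j.  At the fraction [s] of the way from [p] to the nearest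
    pole this is O(s^(j+1)), because |z - p| = s |a_n - p| and no pole is closer to
    [p] than a_n. *)
Lemma taylor_all0_seg p n (s : R) : complex.Im p != 0 ->
  nearest a n (complex.Re p) -> 0 <= s -> s < 1 ->
  (forall j, taylor_rem p j p = 0) ->
  herglotz (p + ofreal s * (ofreal (a n) - p)) = herglotz p.
Proof.
move=> p0 np s0 s1 van; set z := p + _.
have pP := offpole_Im p0.
have zP : forall k, z != ofreal (a k).
  by apply: offpole_Im; rewrite /z ImB_seg mulf_neq0 // subr_eq0 gt_eqF.
set rho := modc (ofreal (a n) - p).
have rho0 : 0 < rho by exact: offpole_gt0.
have rhoP k : rho <= modc (ofreal (a k) - p) by exact: nearest_modc.
have [B HB] := offpole_prod pP zP.
have bnd j : modc (herglotz z - herglotz p) <= rho * B * s ^+ j.+1.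
  rewrite (@taylor_vanish _ j) // modcM modcX.
  have -> : modc (z - p) = s * rho.
    by rewrite /z addrAC subrr add0r modcM modc_ofreal ger0_norm.
  apply: (@le_trans _ _ ((s * rho) ^+ j.+1 * (rho ^- j * B))).
    rewrite ler_wpM2l ?exprn_ge0 ?mulr_ge0 ?(ltW rho0) //.
    apply: (@modc_csum_le _ _ _ _ (fun k => taylor_modc j z k rho0 rhoP)).
    by move=> N; rewrite psumZ ler_wpM2l // invr_ge0 exprn_ge0 // ltW.
  rewrite exprMn [rho ^+ j.+1]exprSr -[leLHS]mulrA.
  rewrite [leRHS]mulrC ler_wpM2l ?exprn_ge0 //.
  by rewrite mulrACA mulfV ?mul1r // expf_neq0 // gt_eqF.
apply/eqP; rewrite -subr_eq0 -modc_eq0 eq_le modc_ge0 andbT.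
have cv : rho * B * s ^+ n0 @[n0 --> \oo] --> (0 : R).
  rewrite -[X in _ --> X](mulr0 (rho * B)); apply: cvgMr.
  by apply: cvg_expr; rewrite ger0_norm.
apply/ler_addgt0Pr => e e0; rewrite add0r; near \oo => m.
have m0 : (0 < m)%N by near: m; exact: nbhs_infty_gt.
apply: le_trans (bnd m.-1) _; rewrite prednK //; apply: ltW.
have : `|0 - rho * B * s ^+ m| < e by near: m; move/cvgrPdist_lt : cv; exact.
by rewrite sub0r normrN ltr_norml => /andP[].
Unshelve. all: by end_near. Qed.

(** Otherwise H + i would vanish on the whole segment from [p] to the nearest pole,
    and by continuity the denominator would vanish at that pole, where its value
    is - w_n.  This replaces the identity theorem. *)
Lemma taylor_not_all0 p n : complex.Im p != 0 -> nearest a n (complex.Re p) ->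
  herglotz p = - 'i%C -> ~ (forall j, taylor_rem p j p = 0).
Proof.
move=> p0 np Hp van; have nn : nearest a n (complex.Re (ofreal (a n))).
  by move=> k; rewrite subrr normr0.
have d0 : denom n (ofreal (a n)) != 0.
  rewrite /denom subrr mul0r addr0 oppr_eq0 -modc_gt0 modc_ofreal.
  by rewrite normr_gt0 gt_eqF.
have := derivable_neq0_near (nbhs_singleton (denom_analytic nn)) d0.
move=> /near_modcP[r r0 rP].
set rho := modc (ofreal (a n) - p).
have rho0 : 0 < rho by apply: offpole_gt0; exact: offpole_Im.
(* [ep] places the point of the segment within the neighbourhood where the
   denominator is nonzero, and close enough for [isolates_near_pole]. *)
pose ep := Num.min (1 / 2) (Num.min (r / 2) (delta / 2) / rho).
have ep0 : 0 < ep by rewrite !(lt_min, divr_gt0).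
have ep1 : ep <= 1 / 2 by rewrite ge_min lexx.
have epr : ep * rho <= Num.min (r / 2) (delta / 2).
  by rewrite -ler_pdivlMr // ge_min lexx orbT.
set z := p + ofreal (1 - ep) * (ofreal (a n) - p).
have zE : z - ofreal (a n) = - ofreal ep * (ofreal (a n) - p).
  by rewrite /z ofrealB -[ofreal 1]/(1 : cplx R); ring.
have zn : modc (z - ofreal (a n)) = ep * rho.
  by rewrite zE modcM modcN modc_ofreal gtr0_norm.
have z0 : z != ofreal (a n) by rewrite -subr_eq0 -modc_gt0 zn mulr_gt0.
have iso : isolates n z.
  by apply: isolates_near_pole; rewrite zn (le_trans epr) // ge_min lexx orbT.
have : denom n z != 0.
  apply: rP; rewrite zn (le_lt_trans epr) // gt_min; apply/orP; left.
  by move: r0; lra.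
rewrite (denomE iso z0) /z taylor_all0_seg //; [|lra|lra].
by rewrite Hp addNr mulr0 eqxx.
Qed.

(** The first nonzero coefficient is the order of the zero of H + i, and the
    corresponding remainder is the nonvanishing analytic factor. *)
Lemma theta_pole n z : nearest a n (complex.Re z) -> complex.Im z < 0 ->
  denom n z = 0 -> pole_at theta z.
Proof.
move=> nz zlt0 d0; have z0 : complex.Im z != 0 by rewrite lt_eqF.
have zP := offpole_Im z0.
have Hz : herglotz z = - 'i%C.
  move/eqP: d0; rewrite (denomE (isolates_self nz)) // mulf_eq0 subr_eq0.
  by rewrite (negPf (zP n)) /= addr_eq0 => /eqP.
have ex_j : exists j, taylor_rem z j z != 0.
  apply: contrapT => h; apply: (taylor_not_all0 z0 nz Hz) => j.
  by apply/eqP; apply: contrapT => /negP h2; apply: h; exists j.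
have /ex_minnP[j tj jmin] := ex_j.
have van i : (i < j)%N -> taylor_rem z i z = 0.
  by move=> ij; apply/eqP; apply: contraTT ij => /jmin; rewrite -leqNgt.
have tA := taylor_analytic j zP z0.
exists j.+1, (fun t => (t - z) ^+ j.+1 + (- (2 * 'i%C)) * (taylor_rem z j t)^-1).
have i0 : ('i%C : cplx R) != 0 by rewrite -modc_gt0 modc_i ltr01.
split; [by []| | |].
- apply: analyticD.
    apply: analyticX; apply: analyticD; [exact: analytic_id|exact: analytic_cst].
  by apply: analyticM; [exact: analytic_cst|exact: analyticV].
- by rewrite subrr expr0n add0r mulf_neq0 ?invr_eq0 // oppr_eq0 mulf_neq0 //.
- have tn := derivable_neq0_near (nbhs_singleton tA) tj.
  near=> t.
  have tz : t != z by near: t; exact: nbhs_dnbhs_neq.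
  have tt : taylor_rem z j t != 0 by near: t; apply: nbhs_dnbhs; exact: tn.
  have tP : forall k, t != ofreal (a k).
    apply: offpole_Im; apply/eqP => t0.
    have : modc (t - z) < `|complex.Im z|.
      near: t; apply: nbhs_dnbhs; apply/near_modcP.
      by exists `|complex.Im z|; rewrite ?normr_gt0.
    move=> /(le_lt_trans (Im_le_modc _)).
    by rewrite ImD ImN t0 sub0r normrN ltxx.
  rewrite /theta; case: asboolP => [[k tk]|_]; first by have := tP k; rewrite tk eqxx.
  have -> : herglotz t + 'i%C = (t - z) ^+ j.+1 * taylor_rem z j t.
    by rewrite -(taylor_vanish zP tP van) Hz opprK.
  have tzj : (t - z) ^+ j.+1 != 0 by rewrite expf_neq0 // subr_eq0.
  by field; rewrite tt tzj.
Unshelve. all: by end_near. Qed.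

Lemma theta_meromorphic : meromorphic theta.
Proof.
move=> z; have [n nz] := a_nearest (complex.Re z).
have [z0|z0] := leP 0 (complex.Im z); first by left; apply: theta_analytic_Im.
have [d0|d0] := eqVneq (denom n z) 0; first by right; apply: theta_pole d0.
by left; apply: theta_analytic d0.
Qed.

(** * The derivative on the real line *)

(** The terms of the quotient rule in which the regular part is not differentiated
    cancel, up to the weight of the pole. *)
Lemma theta_derive n (x : R) (D : cplx R) : nearest a n x ->
  is_derive (ofreal x) 1 (regular_part n) D ->
  'D_1 theta (ofreal x) = 2 * 'i%C *
    (ofreal (w n) + (ofreal x - ofreal (a n)) ^+ 2 * D) * denom n (ofreal x) ^- 2.
Proof.
move=> nx dG; set z := ofreal x.
have nz : nearest a n (complex.Re z) by [].
have d0 : denom n z != 0 by apply: denom_neq0 => //; exact: isolates_self.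
have dsub : is_derive z 1 (fun t : cplx R => t - ofreal (a n)) 1.
  have := @is_deriveB (cplx R) (cplx R) (cplx R) id (cst (ofreal (a n))) z 1 1 0
    (is_derive_id _ _) (is_derive_cst _ _ _).
  by rewrite subr0.
have dGi : is_derive z 1 (fun t => regular_part n t + 'i%C) D.
  have := @is_deriveD (cplx R) (cplx R) (cplx R) (regular_part n) (cst 'i%C) z 1 D 0
    dG (is_derive_cst _ _ _).
  by rewrite addr0.
have dprod := @is_deriveM (cplx R) (cplx R) _ _ z 1 _ _ dsub dGi.
have dden := @is_deriveD (cplx R) (cplx R) (cplx R) (cst (- ofreal (w n))) _ z 1 0 _
  (is_derive_cst _ _ _) dprod.
have ddenE : 'D_1 (denom n) z = (z - ofreal (a n)) * D + (regular_part n z + 'i%C).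
  have -> : denom n = cst (- ofreal (w n)) + ((fun t => t - ofreal (a n)) *
    (fun t => regular_part n t + 'i%C)) by [].
  by rewrite derive_val add0r /GRing.scale /= mulr1.
have ddd : derivable (denom n) z 1 by exact: (@ex_derive _ _ _ _ _ _ _ dden).
have dV : is_derive z 1 (fun t => (denom n t)^-1) (- denom n z ^- 2 *: 'D_1 (denom n) z).
  apply: DeriveDef; first exact: (@derivableV (cplx R) (cplx R) (denom n) z 1 d0 ddd).
  exact: (@deriveV (cplx R) (cplx R) (denom n) z 1 d0 ddd).
have dq := @is_deriveM (cplx R) (cplx R) _ _ z 1 _ _ dsub dV.
have dZ := @is_deriveZ (cplx R) (cplx R) (cplx R) _ (- (2 * 'i%C)) z 1 _ dq.
have dall := @is_deriveD (cplx R) (cplx R) (cplx R) (cst 1) _ z 1 0 _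
  (is_derive_cst _ _ _) dZ.
pose F : cplx R -> cplx R := cst 1 +
  (- (2 * 'i%C)) *: ((fun t => t - ofreal (a n)) * (fun t => (denom n t)^-1)).
have dF : is_derive z 1 F (2 * 'i%C *
    (ofreal (w n) + (z - ofreal (a n)) ^+ 2 * D) * denom n z ^- 2).
  apply: (@is_derive_eq _ _ _ _ _ _ _ _ dall).
  rewrite ddenE add0r /GRing.scale /= mulr1.
  have : denom n z = - ofreal (w n) + (z - ofreal (a n)) * (regular_part n z + 'i%C) by [].
  move: d0; set d := denom n z; set gi := regular_part n z + 'i%C => d0 dE.
  have -> : ofreal (w n) = (z - ofreal (a n)) * gi - d by rewrite dE opprD addrCA subrr addr0 opprK.
  by field.
have Ftheta : \forall t \near z, F t = theta t.
  apply: filterS (near_isolates nz) => t /thetaE ->.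
  rewrite -[LHS]/(1 + - (2 * 'i%C) * ((t - ofreal (a n)) * (denom n t)^-1)).
  by rewrite mulNr !mulrA.
have h := @near_eq_is_derive (cplx R) (cplx R) (cplx R) F theta z 1 _ Ftheta dF.
by rewrite derive_val.
Qed.

Lemma theta_derive_bound (c K' : R) (g : int -> R) : 0 < c -> 0 <= K' ->
  (forall k, c <= w k) ->
  (forall n x, nearest a n x -> \forall N \near \oo,
     `|psum (fun k => w k * ((if k == n then 0 else (a k - x)^-1) -
         (a k - a 0)^-1)) N| <= g n) ->
  (forall n, g n ^+ 2 <= K' * w n) ->
  exists M : R, forall x : R, `|derive1 theta (ofreal x)| <= ofreal M.
Proof.
move=> c0 K'0 cw gP gw; exists (2 * (4 / c + 4 * K' + 16 * K)) => x.
have [n nx] := a_nearest x; set z := ofreal x.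
have iso : isolates n z by apply: isolates_self.
rewrite derive1E (theta_derive nx (regular_derive iso)).
set D := csum _.
have DE : D = ofreal (complex.Re D).
  suff : complex.Im D = 0 by case: (D) => u v /= ->.
  apply: Im_csum_eq0 => k; rewrite -ofrealB -rmorphXn -fmorphV.
  case: eqP => _; first by rewrite mul0r.
  by rewrite Im_ofrealM /= mulr0.
have sD : summable (fun k => (if k == n then 0 else ofreal (w k)) * (ofreal (a k) - z) ^- 2).
  apply: (@summable_le _ _ _ (16 * K) _ (fun N => isolates_sum N iso)) => k.
  rewrite modcM modcV modcX; case: eqP => _; first by rewrite modc0 !mul0r.
  by rewrite modc_ofreal gtr0_norm.
have D0 : 0 <= complex.Re D.
  apply: Re_csum_ge0 => // k; case: eqP => _; first by rewrite mul0r.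
  rewrite -ofrealB -rmorphXn -fmorphV Re_ofrealM /=.
  by rewrite mulr_ge0 // invr_ge0 sqr_ge0.
have DK : complex.Re D <= 16 * K.
  apply: le_trans (ler_norm _) _; apply: le_trans (Re_le_modc _) _.
  apply: (@modc_csum_le _ _ _ _ _ (fun N => isolates_sum N iso)) => k.
  rewrite modcM modcV modcX; case: eqP => _; first by rewrite modc0 !mul0r.
  by rewrite modc_ofreal gtr0_norm.
have GE : regular_part n z = ofreal (complex.Re (regular_part n z)).
  by have := regular_real n x; rewrite -/z; case: (regular_part n z) => u v /= ->.
have Gg : `|complex.Re (regular_part n z)| <= g n.
  apply: le_trans (Re_le_modc _) _.
  apply: modc_csum_le_near; first exact: regular_summable.
  apply: filterS (gP n x nx) => N; congr (_ <= _).
  rewrite -modc_ofreal ofreal_psum; congr modc; apply: eq_psum => k.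
  rewrite /regular_term ofrealM; congr (_ * _).
  rewrite ofrealB [X in _ - X]ofrealV [X in _ - X^-1]ofrealB; congr (_ - _).
  by case: eqP => // _; rewrite ofrealV ofrealB.
set g0 := complex.Re _ in GE Gg.
have g0K : g0 ^+ 2 <= K' * w n.
  apply: le_trans (gw n); rewrite -real_normK ?num_real // lerXn2r ?nnegrE //.
  exact: le_trans Gg.
set t := x - a n; rewrite DE -ofrealB -/t.
have dE : modc (denom n z) ^+ 2 = (t * g0 - w n) ^+ 2 + t ^+ 2.
  rewrite sqr_modc /denom GE -ofrealB -/t ReD ImD ReN ImN Re_ofrealM Im_ofrealM.
  rewrite ReD ImD Re_i Im_i /= !addr0 add0r mulr1 oppr0 add0r.
  by rewrite [- _ + _]addrC.
have -> : ofreal (w n) + ofreal t ^+ 2 * ofreal (complex.Re D) =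
    ofreal (w n + t ^+ 2 * complex.Re D).
  by rewrite -rmorphXn -rmorphM -rmorphD.
have num0 : 0 <= w n + t ^+ 2 * complex.Re D.
  by rewrite addr_ge0 // mulr_ge0 // sqr_ge0.
have dpos : 0 < modc (denom n z) ^+ 2.
  by rewrite exprn_gt0 // modc_gt0 denom_neq0.
rewrite normE lec_ofreal !modcM modcV modcX modc_i mulr1 modc_ofreal ger0_norm //.
have -> : modc (2 : cplx R) = 2.
  by rewrite -[2 in LHS](rmorph_nat (@real_complex R)) -/(ofreal _) modc_ofreal ger0_norm.
rewrite ler_pdivrMr // -[leRHS]mulrA ler_pM2l // dE.
by apply: derive_bound => //; rewrite D0 DK.
Qed.

End InnerFromWeights.

(** * Sums over the integers seen from one point *)

Section Rays.
Variable R : realType.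
Implicit Types (f : int -> R) (n k : int).

Lemma psum_rays f n (N L M : nat) : L%:Z = N%:Z + n -> M%:Z = N%:Z - n - 1 ->
  psum f N = \sum_(j < L) f (n - 1 - j%:Z) + f n + \sum_(j < M) f (n + 1 + j%:Z).
Proof.
pose isum (p : int) (q : nat) := \sum_(i < q) f (p + i%:Z).
have isum_cat p q r : isum p (q + r)%N = isum p q + isum (p + q%:Z) r.
  rewrite /isum big_split_ord /=; congr (_ + _); apply: eq_bigr => i _.
  by rewrite PoszD addrA.
have isum1 p : isum p 1%N = f p by rewrite /isum big_ord1 addr0.
have psumE m : psum f m = isum (- m%:Z) (m + m)%N.
  elim: m => [|m IHm]; first by rewrite /psum /isum !big_ord0.
  rewrite psumS IHm.
  have -> : (m.+1 + m.+1 = 1 + (m + m) + 1)%N by lia.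
  rewrite [RHS]isum_cat [isum _ (1 + _)%N]isum_cat !isum1.
  have -> : - m.+1%:Z + 1%:Z = - m%:Z by lia.
  have -> : - m.+1%:Z + (1 + (m + m))%N%:Z = m%:Z by lia.
  by rewrite NegzE -[RHS]addrA [RHS]addrC -[RHS]addrA.
have isum_rev p q : isum (p - q%:Z) q = \sum_(j < q) f (p - 1 - j%:Z).
  rewrite /isum (reindex_inj rev_ord_inj) /=; apply: eq_bigr => -[i iq] _ /=.
  by congr f; lia.
move=> LE ME; rewrite psumE.
have -> : (N + N = L + (1 + M))%N by lia.
rewrite !isum_cat isum1.
have <- : n = - N%:Z + L%:Z by lia.
have -> : - N%:Z = n - L%:Z by lia.
by rewrite isum_rev addrA.
Qed.

Lemma psum_le_rays f n (A B : R) : (forall k, 0 <= f k) ->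
  (forall L, \sum_(j < L) f (n - 1 - j%:Z) <= A) ->
  (forall M, \sum_(j < M) f (n + 1 + j%:Z) <= B) ->
  forall N, psum f N <= A + f n + B.
Proof.
move=> f0 fA fB N; apply: (@le_trans _ _ (psum f (N + `|n|.+1))).
  by apply: psum_nondecr => //; exact: leq_addr.
have [L LE] : exists L : nat, L%:Z = (N + `|n|.+1)%N%:Z + n.
  by exists (absz ((N + `|n|.+1)%N%:Z + n)%R); lia.
have [M ME] : exists M : nat, M%:Z = (N + `|n|.+1)%N%:Z - n - 1.
  by exists (absz ((N + `|n|.+1)%N%:Z - n - 1)%R); lia.
by rewrite (psum_rays _ LE ME) !lerD.
Qed.

Lemma for_large_bounded f (B : R) : for_large_abs (fun n => f n <= B) ->
  exists2 C : R, 0 < C & forall n, f n <= C.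
Proof.
move=> [N fB]; pose S := psum (fun k => `|f k|) N.+1.
have S0 : 0 <= S by exact: psum_ge0.
exists (`|B| + 1 + S) => [|n]; first by have := normr_ge0 B; lra.
have [nN|Nn] := ltnP `|n| N.+1.
  have := @ler_psum_pt _ (fun k => `|f k|) n N.+1 (fun=> normr_ge0 _) nN.
  by rewrite -/S; have := ler_norm (f n); have := normr_ge0 B; lra.
by have := fB n (ltnW Nn); have := ler_norm B; lra.
Qed.

Lemma for_largeI (P Q : int -> Prop) : for_large_abs P -> for_large_abs Q ->
  for_large_abs (fun n => P n /\ Q n).
Proof.
move=> [N NP] [M MQ]; exists (maxn N M) => n; rewrite geq_max => /andP[h1 h2].
by split; [exact: NP|exact: MQ].
Qed.

Lemma for_largeW (P Q : int -> Prop) : (forall n, P n -> Q n) ->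
  for_large_abs P -> for_large_abs Q.
Proof. by move=> PQ [N NP]; exists N => n /NP /PQ. Qed.

Lemma for_large_shift (P : int -> Prop) (m : int) :
  for_large_abs P -> for_large_abs (fun j => P (j + m)).
Proof. by move=> [N NP]; exists (N + `|m|)%N => j jN; apply: NP; lia. Qed.

End Rays.

(** * Logarithms *)
Section Logarithm.
Variable R : realType.
Implicit Types x y : R.

Lemma ln_le_subr1 x : 0 < x -> ln x <= x - 1.
Proof.
by move=> x0; have := @le_ln1Dx R (x - 1); rewrite addrCA subrr addr0; apply; lra.
Qed.

Lemma le_ln x y : 0 < x -> x <= y -> ln x <= ln y.
Proof.
by move=> x0 xy; rewrite ler_ln ?posrE //; apply: lt_le_trans xy.
Qed.

(** - 1 / ln is a primitive of 1 / (x ln^2 x), which decreases. *)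
Lemma inv_ln_telescope x : 2 < x ->
  (x * ln x ^+ 2)^-1 <= (ln (x - 1))^-1 - (ln x)^-1.
Proof.
move=> x2; have x0 : 0 < x by lra.
have l1 : 0 < ln (x - 1) by apply: ln_gt0; lra.
have l01 : ln (x - 1) <= ln x by apply: le_ln; lra.
have l0 : 0 < ln x by lra.
have d : x^-1 <= ln x - ln (x - 1).
  have : ln ((x - 1) / x) <= (x - 1) / x - 1.
    by apply: ln_le_subr1; rewrite divr_gt0 //; lra.
  rewrite ln_div ?posrE //; last lra.
  by rewrite mulrBl divff ?gt_eqF // mul1r; lra.
have -> : (ln (x - 1))^-1 - (ln x)^-1 = (ln x - ln (x - 1)) * (ln (x - 1) * ln x)^-1.
  by field; rewrite !gt_eqF.
rewrite invfM; apply: ler_pM => //; rewrite ?invr_ge0 ?sqr_ge0 ?(ltW x0) //.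
rewrite lef_pV2 ?posrE ?mulr_gt0 ?exprn_gt0 // expr2 ler_wpM2r //; exact: ltW.
Qed.

Lemma sum_inv_xln2 (M : nat) :
  \sum_(j < M) ((j + 3)%:R * ln ((j + 3)%:R : R) ^+ 2)^-1 <= (ln 2)^-1.
Proof.
suff H : \sum_(j < M) ((j + 3)%:R * ln ((j + 3)%:R : R) ^+ 2)^-1 <=
    (ln 2)^-1 - (ln (M + 2)%:R)^-1.
  by apply: le_trans H _; rewrite lerBlDr lerDl invr_ge0 ln_ge0 // ler1n addn2.
elim: M => [|M IHM]; first by rewrite big_ord0 subrr.
rewrite big_ord_recr /=; have := @inv_ln_telescope (M + 3)%:R.
have -> : (M + 3)%:R - 1 = (M + 2)%:R :> R.
  by rewrite [in LHS]addnS -natr1 addrK.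
have -> : (M.+1 + 2 = M + 3)%N by lia.
have -> : 2 < (M + 3)%:R :> R by rewrite (ltr_nat R 2); lia.
by move=> /(_ isT); move: IHM; lra.
Qed.

End Logarithm.

(** * Increasing and separated sequences *)
Section Increasing.
Variables (R : realType) (a : int -> R).
Hypothesis a_incr : {homo a : n m / n < m}.
Implicit Types (n m : int).

Lemma incr_le n m : n <= m -> a n <= a m.
Proof. by rewrite le_eqVlt => /orP[/eqP ->//|/a_incr/ltW]. Qed.

Lemma incr_ltE n m : (a n < a m) = (n < m).
Proof.
apply/idP/idP => [|/a_incr//]; apply: contraTT; rewrite -!leNgt; exact: incr_le.
Qed.

End Increasing.

Section Unbounded.
Variables (R : realType) (a : int -> R).
Hypothesis a_incr : {homo a : n m / n < m}.
Hypothesis a_pinf : forall A, exists n, A <= a n.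
Hypothesis a_ninf : forall A, exists n, a n <= A.
Implicit Types (n k : int).

Lemma incr_bracket x : exists n, a n <= x < a (n + 1).
Proof.
have [p px] := a_ninf x; have [q xq] := a_pinf (x + 1).
have ex_i : exists i : nat, x < a (p + i%:Z + 1).
  exists (absz (q - p)%R); apply: (@lt_le_trans _ _ (a q)); first lra.
  by apply: (incr_le a_incr); lia.
have [i xi imin] := ex_minnP ex_i; exists (p + i%:Z); rewrite xi andbT.
case: i xi imin => [|i] xi imin; first by rewrite addr0.
rewrite leNgt; apply/negP => h.
have : (i.+1 <= i)%N by apply: imin; rewrite -addrA (_ : i%:Z + 1 = i.+1%:Z) //; lia.
by rewrite ltnn.
Qed.

Lemma exists_nearest x : exists n, nearest a n x.
Proof.
have [n /andP[nx xn]] := incr_bracket x.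
have dl : `|x - a n| = x - a n by rewrite ger0_norm // subr_ge0.
have dr : `|x - a (n + 1)| = a (n + 1) - x.
  by rewrite distrC ger0_norm // subr_ge0 ltW.
have left_k k : k <= n -> `|x - a n| <= `|x - a k|.
  move=> /(incr_le a_incr) kn; rewrite dl ger0_norm ?lerD2l ?lerN2 //; lra.
have right_k k : n + 1 <= k -> `|x - a (n + 1)| <= `|x - a k|.
  move=> /(incr_le a_incr) kn; rewrite dr distrC ger0_norm; lra.
have [c|c] := leP `|x - a n| `|x - a (n + 1)|.
  exists n => k; have [/left_k //|nk] := leP k n.
  by apply: (le_trans c); apply: right_k; lia.
exists (n + 1) => k; have [kn|nk] := leP k n; last by apply: right_k; lia.
by apply: (le_trans (ltW c)); exact: left_k.
Qed.

End Unbounded.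

Section Separated.
Variables (R : realType) (a : int -> R) (delta : R).
Hypothesis a_incr : {homo a : n m / n < m}.
Hypothesis delta_gt0 : 0 < delta.
Hypothesis a_sep : forall n m : int, n != m -> delta < `|a n - a m|.
Implicit Types (n m : int).

Lemma sep_step n (j : nat) : delta * j%:R <= a (n + j%:Z) - a n.
Proof.
elim: j => [|j IHj]; first by rewrite mulr0 addr0 subrr.
have : delta < `|a (n + j.+1%:Z) - a (n + j%:Z)| by apply: a_sep; apply/eqP; lia.
rewrite gtr0_norm; last by rewrite subr_gt0 (incr_ltE a_incr); lia.
by move: IHj; rewrite -[j.+1]addn1 natrD mulrDr mulr1; lra.
Qed.

Lemma sep_lower_bound : exists2 C : R, 0 <= C & forall n, delta * `|n|%N%:R - C <= `|a n|.
Proof.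
exists `|a 0| => // -[j|j].
  have := sep_step 0 j; rewrite add0r absz_nat.
  by have := ler_norm (a j); have := ler_norm (- a 0); rewrite normrN; lra.
have := sep_step (Negz j) j.+1; rewrite NegzE addNr abszN absz_nat.
by have := ler_norm (- a (- j.+1%:Z)); have := ler_norm (a 0); rewrite normrN; lra.
Qed.

Lemma sep_large A : for_large_abs (fun n => A <= `|a n|).
Proof.
have [C C0 aC] := sep_lower_bound.
have [N NA] : exists N : nat, (A + C) / delta <= N%:R.
  exists (Num.truncn `|(A + C) / delta|).+1.
  apply: le_trans (ler_norm _) _; apply: ltW; exact: truncnS_gt.
exists N => n nN; apply: le_trans (aC n); rewrite lerBrDr.
rewrite mulrC -ler_pdivrMr //; apply: le_trans NA _.
by rewrite ler_nat.
Qed.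

Section SquaredLogGaps.
Variables (M : nat) (c : R).
Hypothesis M_gt0 : (0 < M)%N.
Hypothesis c_gt0 : 0 < c.
Hypothesis gapM : forall j, c * ln (2 + `|j|%N%:R) ^+ 2 <= a (j + M%:Z) - a j.

Let ell (q : nat) : R := ln (2 + q%:R).

Let ell_gt0 q : 0 < ell q.
Proof. by apply: ln_gt0; have := ler0n R q; lra. Qed.

Let ell_ge0 q : 0 <= ell q. Proof. exact: ltW. Qed.

Let ell_le p q : (p <= q)%N -> ell p <= ell q.
Proof.
move=> pq; apply: le_ln; first by have := ler0n R p; lra.
by rewrite lerD2l ler_nat.
Qed.

Lemma gap_chain j0 (q : nat) (L : R) :
  (forall i : nat, (i < q)%N -> L <= a (j0 + (M * i)%N%:Z + M%:Z) - a (j0 + (M * i)%N%:Z)) ->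
  q%:R * L <= a (j0 + (M * q)%N%:Z) - a j0.
Proof.
elim: q => [_|q IHq gL]; first by rewrite mul0r muln0 addr0 subrr.
have h1 := IHq (fun i iq => gL i (ltnW iq)).
have := gL q (ltnSn q).
have -> : j0 + (M * q)%N%:Z + M%:Z = j0 + (M * q.+1)%N%:Z by lia.
by rewrite -[q.+1]addn1 natrD mulrDl mul1r; move: h1; lra.
Qed.

(** Among the steps made from n to n + 4 M q, those of the first quarter (for n below
    - 2 M q) or those of the last quarter (otherwise) all start at an index of
    absolute value at least q, where the gaps are at least c ln^2(2 + q). *)
Lemma gap_quarter n (q : nat) : q%:R * (c * ell q ^+ 2) <= a (n + (4 * M * q)%N%:Z) - a n.
Proof.
have gapq j : (q <= `|j|)%N -> c * ell q ^+ 2 <= a (j + M%:Z) - a j.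
  move=> qj; apply: le_trans (gapM j); rewrite ler_pM2l //.
  by rewrite lerXn2r ?nnegrE ?ell_ge0 ?ell_le.
have qM : (q <= M * q)%N by rewrite leq_pmull.
have [nq|nq] := leP (- (2 * M * q)%N%:Z) n.
  have : q%:R * (c * ell q ^+ 2) <=
      a (n + (3 * M * q)%N%:Z + (M * q)%N%:Z) - a (n + (3 * M * q)%N%:Z).
    by apply: gap_chain => i iq; apply: gapq; lia.
  have -> : n + (3 * M * q)%N%:Z + (M * q)%N%:Z = n + (4 * M * q)%N%:Z by lia.
  have : a n <= a (n + (3 * M * q)%N%:Z) by apply: (incr_le a_incr); lia.
  lra.
have : q%:R * (c * ell q ^+ 2) <= a (n + (M * q)%N%:Z) - a n.
  apply: gap_chain => i iq; apply: gapq.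
  have : (M * i <= M * q)%N by rewrite leq_mul2l ltnW ?orbT.
  lia.
have : a (n + (M * q)%N%:Z) <= a (n + (4 * M * q)%N%:Z) by apply: (incr_le a_incr); lia.
lra.
Qed.

(** Take q to be the quotient of m by 4 M: then m + 2 <= 9 M q, and since
    m + 2 is at most a power of 2 + q with fixed exponent, the logarithms of 2 + m
    and 2 + q are comparable.  For small m separation is enough. *)
Lemma gap_growth : exists2 kap : R, 0 < kap & forall n (m : nat), (0 < m)%N ->
  kap * ((m + 2)%:R * ell m ^+ 2) <= a (n + m%:Z) - a n.
Proof.
pose E := (9 * M)%N.
have E0 : 0 < E%:R :> R by rewrite ltr0n; lia.
pose A := (4 * M + 2)%:R * ell (4 * M) ^+ 2.
have A0 : 0 < A by rewrite mulr_gt0 ?exprn_gt0 ?ell_gt0 // ltr0n; lia.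
have k1 : 0 < c / (E%:R * E%:R ^+ 2) by rewrite divr_gt0 // mulr_gt0 // exprn_gt0.
exists (Num.min (delta / A) (c / (E%:R * E%:R ^+ 2))).
  by rewrite lt_min k1 divr_gt0.
move=> n m m0; have P0 : 0 <= (m + 2)%:R * ell m ^+ 2.
  by rewrite mulr_ge0 // sqr_ge0.
have [mM|Mm] := ltnP m (4 * M).
  apply: (@le_trans _ _ (delta / A * ((m + 2)%:R * ell m ^+ 2))).
    by rewrite ler_wpM2r // ge_min lexx.
  apply: (@le_trans _ _ (delta * m%:R)); last exact: sep_step.
  apply: (@le_trans _ _ delta); last by rewrite ler_pMr // ler1n.
  rewrite mulrAC ler_pdivrMr // ler_wpM2l ?(ltW delta_gt0) // /A.
  apply: ler_pM => //; rewrite ?sqr_ge0 // ?ler_nat; first lia.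
  by rewrite lerXn2r ?nnegrE ?ell_ge0 ?ell_le // ltnW.
pose q := (m %/ (4 * M))%N.
have q0 : (0 < q)%N by rewrite divn_gt0 //; lia.
have qm : (4 * M * q <= m)%N by rewrite mulnC leq_trunc_div.
have mq : (m < 4 * M * q.+1)%N by rewrite mulnC ltn_ceil //; lia.
have mE : (m + 2 <= E * q)%N.
  have Mq : (0 < M * q)%N by rewrite muln_gt0 M_gt0.
  have : (M <= M * q)%N by rewrite leq_pmulr.
  have : (4 * M * q.+1 = 4 * (M * q) + 4 * M)%N by lia.
  have : (E * q = 9 * (M * q))%N by rewrite /E; lia.
  lia.
have lE : ell m <= E%:R * ell q.
  have -> : E%:R * ell q = ln ((2 + q%:R) ^+ E) :> R.
    by rewrite lnXn ?mulr_natl //; have := ler0n R q; lra.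
  apply: le_ln; first by have := ler0n R m; lra.
  rewrite -!natrD -natrX ler_nat.
  have E1 : E = E.-1.+1 by rewrite prednK //; lia.
  rewrite {1}E1 expnS.
  have h1 : (E.-1 < 2 ^ E.-1)%N by exact: ltn_expl.
  have h2 : (2 ^ E.-1 <= (2 + q) ^ E.-1)%N by rewrite leq_exp2r //; lia.
  have h3 : (E <= (2 + q) ^ E.-1)%N by lia.
  apply: (@leq_trans ((2 + q) * E)); last by rewrite leq_mul2l h3 orbT.
  by move: mE; rewrite mulnC; lia.
apply: (@le_trans _ _ (c / (E%:R * E%:R ^+ 2) * ((m + 2)%:R * ell m ^+ 2))).
  by rewrite ler_wpM2r // ge_min lexx orbT.
apply: (@le_trans _ _ (a (n + (4 * M * q)%N%:Z) - a n)); last first.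
  by rewrite lerD2r; apply: (incr_le a_incr); lia.
apply: le_trans (gap_quarter n q).
apply: (@le_trans _ _ (c / (E%:R * E%:R ^+ 2) * ((E%:R * q%:R) * (E%:R * ell q) ^+ 2))).
  rewrite ler_pM2l //; apply: ler_pM => //; first exact: sqr_ge0.
    by rewrite -natrM ler_nat.
  by rewrite lerXn2r ?nnegrE ?mulr_ge0 ?ler0n ?ell_ge0.
rewrite le_eqVlt; apply/orP; left; apply/eqP; field.
by rewrite gt_eqF.
Qed.

(** By [gap_growth] the sum is dominated, on each side of n, by the convergent
    series of 1 / (m ln^2 m), uniformly in n. *)
Lemma inverse_sum_bounded : exists2 S : R, 0 < S & forall n N,
  psum (fun k => `|a k - a n|^-1) N <= S.
Proof.
have [kap kap0 kapP] := gap_growth.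
pose T := kap^-1 * (ln 2)^-1.
have T0 : 0 < T by rewrite mulr_gt0 ?invr_gt0 // ln_gt0 //; lra.
have ray (u : nat -> R) : (forall j, kap * ((j + 3)%:R * ln ((j + 3)%:R) ^+ 2) <= u j) ->
    forall L, \sum_(j < L) (u j)^-1 <= T.
  move=> uP L; apply: (@le_trans _ _ (kap^-1 *
      \sum_(j < L) ((j + 3)%:R * ln ((j + 3)%:R : R) ^+ 2)^-1)).
    rewrite mulr_sumr; apply: ler_sum => j _; rewrite -invfM.
    have P0 : 0 < kap * ((j + 3)%:R * ln ((j + 3)%:R) ^+ 2).
      rewrite !mulr_gt0 ?exprn_gt0 ?ln_gt0 // ?ltr0n ?(ltr_nat R 1); lia.
    by rewrite lef_pV2 ?posrE //; apply: lt_le_trans (uP j).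
  by rewrite ler_pM2l ?invr_gt0 // sum_inv_xln2.
exists (T + 0 + T); first by rewrite addr0 addr_gt0.
move=> n; have -> : 0 = `|a n - a n|^-1 :> R by rewrite subrr normr0 invr0.
have elE (j : nat) : (2 + j.+1%:R : R) = (j + 3)%:R.
  by rewrite -natrD; congr _%:R; lia.
apply: psum_le_rays => [k|L|L]; first by rewrite invr_ge0.
  apply: (ray (fun j : nat => `|a (n - 1 - j%:Z) - a n|)) => j /=; rewrite distrC ger0_norm; last by rewrite subr_ge0 (incr_le a_incr) //; lia.
  have := kapP (n - 1 - j%:Z) j.+1 isT; rewrite /ell elE.
  have -> : n - 1 - j%:Z + j.+1%:Z = n by lia.
  by have -> : (j.+1 + 2 = j + 3)%N by lia.
apply: (ray (fun j : nat => `|a (n + 1 + j%:Z) - a n|)) => j /=; rewrite ger0_norm; last by rewrite subr_ge0 (incr_le a_incr) //; lia.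
have := kapP n j.+1 isT; rewrite /ell elE.
have -> : n + 1 + j%:Z = n + j.+1%:Z by lia.
by have -> : (j.+1 + 2 = j + 3)%N by lia.
Qed.

End SquaredLogGaps.

End Separated.

(** * Sequences with gaps growing like a squared logarithm *)

Section UnitWeights.
Variables (R : realType) (a : int -> R) (delta S : R).
Hypothesis delta_gt0 : 0 < delta.
Hypothesis a_sep : forall n m : int, n != m -> delta < `|a n - a m|.
Hypothesis S_gt0 : 0 < S.
Hypothesis inv_sum : forall n N, psum (fun k => `|a k - a n|^-1) N <= S.

Lemma unit_square_sum n N : psum (fun k => 1 / (a k - a n) ^+ 2) N <= delta^-1 * S.
Proof.
apply: (@le_trans _ _ (psum (fun k => delta^-1 * `|a k - a n|^-1) N)).
  apply: ler_psum => k; have [->|kn] := eqVneq k n.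
    by rewrite subrr normr0 expr0n /= invr0 !mulr0.
  rewrite div1r -exprVn -real_normK ?num_real // normfV expr2.
  rewrite ler_wpM2r ?invr_ge0 // lef_pV2 ?posrE //; first by apply: ltW; apply: a_sep.
  exact: lt_trans (a_sep kn).
by rewrite psumZ ler_wpM2l // invr_ge0 ltW.
Qed.

(** With unit weights nothing has to cancel: the sums converge absolutely, and
    passing from a_n to a point whose nearest pole is a_n doubles each term at
    most. *)
Lemma unit_balance n x N : nearest a n x ->
  `|psum (fun k => 1 * ((if k == n then 0 else (a k - x)^-1) - (a k - a 0)^-1)) N|
  <= 3 * S.
Proof.
move=> nx; apply: le_trans (ler_norm_psum _ _) _.
apply: (@le_trans _ _ (psum (fun k => 2 * `|a k - a n|^-1 + `|a k - a 0|^-1) N)).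
  apply: ler_psum => k; rewrite mul1r; apply: le_trans (ler_normB _ _) _.
  rewrite normfV lerD2r; have [_|kn] := eqVneq k n.
    by rewrite normr0 mulr_ge0 // invr_ge0.
  have d0 : 0 < `|a k - a n| := lt_trans delta_gt0 (a_sep kn).
  have h1 := nearest_dist k nx.
  have x0 : 0 < `|a k - x| by lra.
  by rewrite normfV ler_pdivlMr // mulrC ler_pdivrMr //; lra.
rewrite psumD psumZ; have := inv_sum n N; have := inv_sum 0 N; lra.
Qed.

End UnitWeights.

Section LogGrowth.
Variables (R : realType) (a : int -> R) (delta : R).
Hypothesis a_incr : {homo a : n m / n < m}.
Hypothesis delta_gt0 : 0 < delta.
Hypothesis a_sep : forall n m : int, n != m -> delta < `|a n - a m|.

(** By separation |a_j| grows at least linearly, so 2 + |j| is at most |a_j|^2 for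
    large |j|. *)
Lemma ln_index : for_large_abs (fun j : int => ln (2 + `|j|%N%:R) <= 2 * ln `|a j|).
Proof.
have [C C0 aC] := sep_lower_bound a_incr delta_gt0 a_sep.
have di : 0 < delta^-1 by rewrite invr_gt0.
pose X := 2 + (1 + C) * delta^-1.
apply: for_largeW (sep_large a_incr delta_gt0 a_sep X) => j Xa.
have p0 : 0 <= (1 + C) * delta^-1 by rewrite mulr_ge0 ?addr_ge0 // ltW.
have a1 : 1 <= `|a j| by move: Xa; rewrite /X; lra.
have a0 : 0 < `|a j| by lra.
have -> : 2 * ln `|a j| = ln (`|a j| ^+ 2) by rewrite lnXn // mulr_natl.
have j0 := ler0n R `|j|%N.
apply: le_ln; first lra.
have : `|j|%N%:R <= (`|a j| + C) * delta^-1.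
  by rewrite -[_ * delta^-1]/(_ / delta) ler_pdivlMr // mulrC; have := aC j; lra.
move: Xa; rewrite /X; set y := `|a j| in a1 a0 *; set e := delta^-1 in di p0 *.
set J := (`|j|%N%:R) in j0 * => yX JC.
have h1 : 0 <= (y - 1) * (C * e) by rewrite mulr_ge0 ?subr_ge0 // mulr_ge0 // ltW.
have h2 : 0 <= y * (y - (2 + (1 + C) * e)) by rewrite mulr_ge0 ?subr_ge0 // ltW.
by nra.
Qed.

Lemma gap_of_eventual (M : nat) (B : R) : (0 < M)%N ->
  for_large_abs (fun j : int => ln (2 + `|j|%N%:R) ^+ 2 <= B * (a (j + M%:Z) - a j)) ->
  exists2 c : R, 0 < c & forall j : int,
    c * ln (2 + `|j|%N%:R) ^+ 2 <= a (j + M%:Z) - a j.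
Proof.
move=> M0 ev; have gap0 j : 0 < a (j + M%:Z) - a j.
  by rewrite subr_gt0; apply: a_incr; lia.
have [C C0 HC] : exists2 C : R, 0 < C & forall j : int,
    ln (2 + `|j|%N%:R) ^+ 2 / (a (j + M%:Z) - a j) <= C.
  by apply: (@for_large_bounded _ _ B); apply: for_largeW ev => j; rewrite ler_pdivrMr.
exists C^-1; rewrite ?invr_gt0 // => j.
by rewrite mulrC ler_pdivrMr // mulrC -ler_pdivrMr.
Qed.

Lemma large_gap_growth : large_gap_condition a ->
  exists2 c : R, 0 < c & forall j : int,
    c * ln (2 + `|j|%N%:R) ^+ 2 <= a (j + 1%N%:Z) - a j.
Proof.
move=> [_ [c c0 lc]]; apply: (@gap_of_eventual 1%N (16 * c)) => //.
have both := for_largeI lc ln_index.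
have large0 : for_large_abs (fun j : int => j != 0) by exists 1%N => j; lia.
apply: for_largeW (for_largeI large0 (for_largeI both (for_large_shift 1 both))).
move=> j [jn0 [[h1 h2] [h3 h4]]].
have l0 (i : nat) : 0 <= ln (2 + i%:R) :> R by apply: ln_ge0; have := ler0n R i; lra.
have sq (u v : R) : 0 <= u -> u <= 2 * v -> u ^+ 2 <= 4 * v ^+ 2.
  move=> u0 uv; rewrite (_ : 4 = 2 ^+ 2) -?exprMn; last by rewrite expr2; lra.
  by rewrite lerXn2r ?nnegrE // (le_trans u0).
have [j0|j0] := ltP 0 j.
  move: h1; rewrite /gap j0; have := sq _ _ (l0 _) h2.
  have := sqr_ge0 (ln `|a j|); move: c0.
  set u := ln `|a j| ^+ 2; set v := ln _ ^+ 2; set t := a _ - _; lra.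
move: h3; rewrite /gap ifN; last by lia.
rewrite addrK; have h5 := sq _ _ (l0 _) h4.
have h6 : ln (2 + `|j|%N%:R) <= 2 * ln (2 + (absz (j + 1)%R)%:R) :> R.
  have p (i : nat) : 0 < 2 + i%:R :> R by have := ler0n R i; lra.
  have -> : 2 * ln (2 + (absz (j + 1)%R)%:R) = ln ((2 + (absz (j + 1)%R)%:R) ^+ 2) :> R.
    by rewrite lnXn ?mulr_natl.
  apply: le_ln => //; rewrite -!natrD -natrX ler_nat.
  have : (absz j <= absz (j + 1)%R + 1)%N by lia.
  by move: (absz j) (absz (j + 1)%R) => p1 p2; rewrite expnS expn1; nia.
have h7 := sq _ _ (l0 _) h6; move: h5 h7 c0.
set u := ln _ ^+ 2; set v := ln _ ^+ 2; set t := ln _ ^+ 2; set g := a _ - _; lra.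
Qed.

(** ln^2 |a_j| = O(|a_j|) and ln (2 + |j|) = O(ln |a_j|), so that an advance
    proportional to |a_j| is more than what is needed. *)
Lemma gap_of_ratio (M : nat) (d : R) : (0 < M)%N -> 0 < d ->
  for_large_abs (fun j : int => d * `|a j| <= a (j + M%:Z) - a j) ->
  exists2 c : R, 0 < c & forall j : int,
    c * ln (2 + `|j|%N%:R) ^+ 2 <= a (j + M%:Z) - a j.
Proof.
move=> M0 d0 ev; apply: (@gap_of_eventual _ (16 / d)) => //.
have big := sep_large a_incr delta_gt0 a_sep 1.
apply: for_largeW (for_largeI ev (for_largeI big ln_index)) => j [h1 [h2 h3]].
rewrite mulrAC ler_pdivlMr // mulrC.
have a0 : 0 < `|a j| by lra.
have l0 : 0 <= ln (2 + `|j|%N%:R) :> R by apply: ln_ge0; have := ler0n R `|j|%N; lra.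
have s0 : 0 < Num.sqrt `|a j| by rewrite sqrtr_gt0.
have sE : Num.sqrt `|a j| ^+ 2 = `|a j| by rewrite sqr_sqrtr.
have h4 : ln `|a j| <= 2 * Num.sqrt `|a j|.
  rewrite -{1}sE lnXn // mulr_natl lerMn2r /=.
  by apply: ltW; exact: ln_sublinear.
have h5 : ln (2 + `|j|%N%:R) ^+ 2 <= (4 * Num.sqrt `|a j|) ^+ 2.
  by rewrite lerXn2r ?nnegrE // ?mulr_ge0 ?sqrtr_ge0 //; lra.
rewrite exprMn sE in h5; move: h1 h5; set u := ln _ ^+ 2; nra.
Qed.

Hypothesis a_pinf : forall A, exists n, A <= a n.
Hypothesis a_ninf : forall A, exists n, a n <= A.

Section Clusters.
Variables (d : R) (m : int -> nat) (b : int -> nat -> R) (M : nat).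
Hypothesis d_gt0 : 0 < d.
Hypothesis m_le : forall n, (m n <= M)%N.
Hypothesis m_gt0 : forall n, (1 <= m n)%N.
Hypothesis b_in : forall n j, (1 <= j < m n)%N -> b n j < b n j.+1.
Hypothesis b_next : forall n, b n (m n) < b (n + 1) 1%N.
Hypothesis b_range : forall k, exists pj : int * nat,
  (1 <= pj.2 <= m pj.1)%N /\ b pj.1 pj.2 = a k.
Hypothesis ratio_pos : forall n : int, 0 <= n -> forall j l,
  (1 <= j <= m (n + 1))%N -> (1 <= l <= m n)%N -> d < b (n + 1) j / b n l - 1.
Hypothesis ratio_neg : forall n : int, n < 0 -> forall j l,
  (1 <= j <= m (n - 1))%N -> (1 <= l <= m n)%N -> d < b (n - 1) j / b n l - 1.

Lemma b_mono n i j : (1 <= i)%N -> (i <= j)%N -> (j <= m n)%N -> b n i <= b n j.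
Proof.
move=> i1 /subnK <-; elim: (j - i)%N => [//|q IHq]; rewrite addSn => qm.
apply: le_trans (IHq (ltnW qm)) _; apply: ltW; apply: b_in; lia.
Qed.

Lemma b_mono_out (q : nat) n i j : (1 <= i <= m n)%N ->
  (1 <= j <= m (n + q.+1%:Z))%N -> b n i < b (n + q.+1%:Z) j.
Proof.
move=> /andP[i1 im]; elim: q j => [|q IHq] j /andP[j1 jm].
  apply: (@le_lt_trans _ _ (b n (m n))); first exact: b_mono.
  by apply: lt_le_trans (b_next n) _; exact: b_mono.
apply: (@lt_le_trans _ _ (b (n + q.+2%:Z) 1%N)); last exact: b_mono.
have -> : n + q.+2%:Z = n + q.+1%:Z + 1 by lia.
apply: lt_trans (b_next _); apply: IHq; exact/andP.
Qed.

Lemma b_lt_out p q i j : p < q -> (1 <= i <= m p)%N -> (1 <= j <= m q)%N ->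
  b p i < b q j.
Proof.
move=> pq ip jq; have [r rE] : exists r : nat, q = p + r.+1%:Z.
  by exists (absz (q - p)%R).-1; lia.
by move: jq; rewrite rE => jq; exact: b_mono_out.
Qed.

(** Since clusters have at most [M] points and are enumerated in increasing order,
    [M] steps always lead to a later cluster.  Its points are at least 1 + d times
    larger far to the right; far to the left the earlier cluster is at least 1 + d
    times larger in absolute value, which leaves the factor d / (1 + d). *)
Lemma cluster_ratio : for_large_abs (fun j : int =>
  d / (1 + d) * `|a j| <= a (j + M%:Z) - a j).
Proof.
have [c cP] := choice b_range; pose cl k := (c k).1.
have a_ltE := incr_ltE a_incr.
have cl_mono (k k' : int) : k <= k' -> cl k <= cl k'.
  move=> kk'; rewrite leNgt; apply/negP => lt.
  have [k1 k2] := cP k; have [k3 k4] := cP k'.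
  have := b_lt_out lt k3 k1; rewrite k2 k4.
  by rewrite ltNge (incr_le a_incr).
have M0 : (0 < M)%N by exact: leq_trans (m_gt0 0) (m_le 0).
have cl_step k : cl k + 1 <= cl (k + M%:Z).
  rewrite leNgt; apply/negP => lt.
  have same (i : nat) : (i <= M)%N -> cl (k + i%:Z) = cl k.
    by move=> iM; have := @cl_mono k (k + i%:Z); have := @cl_mono (k + i%:Z) (k + M%:Z); lia.
  have idx (i : nat) : (i <= M)%N -> (i.+1 <= (c (k + i%:Z)%R).2)%N.
    elim: i => [_|i IHi iM]; first by have [/andP[]] := cP (k + 0).
    apply: leq_ltn_trans (IHi (ltnW iM)) _; rewrite ltnNge; apply/negP => le.
    have [/andP[h1 h2] h3] := cP (k + i%:Z); have [/andP[h4 h5] h6] := cP (k + i.+1%:Z).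
    have s1 := same i (ltnW iM); have s2 := same i.+1 iM; rewrite /cl in s1 s2.
    have : b (c (k + i%:Z)).1 (c (k + i.+1%:Z)).2 <= b (c (k + i%:Z)).1 (c (k + i%:Z)).2.
      exact: b_mono.
    rewrite h3 s1 -s2 h6 leNgt => /negP; apply; rewrite a_ltE; lia.
  have [/andP[_ h] _] := cP (k + M%:Z).
  by have := idx M (leqnn M); have := m_le (c (k + M%:Z)).1; lia.
have cl_up (i : nat) : cl 0 + i%:Z <= cl ((M * i)%N%:Z).
  elim: i => [|i IHi]; first by rewrite muln0 addr0.
  have -> : (M * i.+1)%N%:Z = (M * i)%N%:Z + M%:Z by lia.
  by have := cl_step (M * i)%N%:Z; lia.
have cl_down (i : nat) : cl (- (M * i)%N%:Z) <= cl 0 - i%:Z.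
  elim: i => [|i IHi]; first by rewrite muln0 oppr0 subr0.
  have := cl_step (- (M * i.+1)%N%:Z).
  have -> : - (M * i.+1)%N%:Z + M%:Z = - (M * i)%N%:Z by lia.
  lia.
have [q0 q0P] := a_pinf 1; have [q1 q1P] := a_ninf (-1).
have d1 : 0 < 1 + d by rewrite addr_gt0.
have [A AE] : exists A : nat, A = absz (cl 0) by exists (absz (cl 0)).
exists (M * A + 2 * M + absz q0 + absz q1)%N => j jN.
have [j0|j0] := leP 0 j.
  have cj : 0 <= cl j.
    apply: (@le_trans _ _ (cl ((M * A)%N%:Z))).
      by have := cl_up A; lia.
    by apply: cl_mono; lia.
  have aj : 1 <= a j by apply: (le_trans q0P); apply: (incr_le a_incr); lia.
  have [h1 h2] := cP j; have [h3 h4] := cP (j + M%:Z).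
  have step := cl_step j; rewrite -/(cl j) in h1 h2; rewrite -/(cl (j + M%:Z)) in h3 h4.
  have first1 : (1 <= 1 <= m (cl j + 1))%N by rewrite m_gt0.
  have := ratio_pos cj first1 h1; rewrite h2 ltrBrDr ltr_pdivlMr; last lra.
  have : b (cl j + 1) 1%N <= a (j + M%:Z).
    rewrite -h4; have [e|ne] := eqVneq (cl j + 1) (cl (j + M%:Z)).
      by rewrite e; case/andP: h3 => *; exact: b_mono.
    by apply: ltW; apply: b_lt_out => //; lia.
  rewrite gtr0_norm; last lra.
  have : d / (1 + d) * a j <= d * a j.
    rewrite ler_wpM2r //; first lra.
    by rewrite ler_pdivrMr //; move: d_gt0; nra.
  by lra.
have cJ : cl (j + M%:Z) < 0.
  apply: (@le_lt_trans _ _ (cl (- (M * A.+1)%N%:Z))).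
    by apply: cl_mono; rewrite mulnS; lia.
  by have := cl_down A.+1; lia.
have aJ : a (j + M%:Z) <= -1 by apply: (le_trans _ q1P); apply: (incr_le a_incr); lia.
have [h1 h2] := cP j; have [h3 h4] := cP (j + M%:Z).
have step := cl_step j; rewrite -/(cl j) in h1 h2; rewrite -/(cl (j + M%:Z)) in h3 h4.
set q := cl (j + M%:Z) in cJ h3 h4 step.
have last1 : (1 <= m (q - 1) <= m (q - 1))%N by rewrite m_gt0 leqnn.
have := ratio_neg cJ last1 h3; rewrite h4 ltrBrDr ltr_ndivlMr; last lra.
have : a j <= b (q - 1) (m (q - 1)).
  rewrite -h2; have [e|ne] := eqVneq (cl j) (q - 1).
    by rewrite e; rewrite e in h1; case/andP: h1 => *; exact: b_mono.
  by apply: ltW; apply: b_lt_out => //; lia.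
move=> u1 u2; have aj : a j < (1 + d) * a (j + M%:Z) by move: u1 u2; lra.
have aj0 : a j < 0 by apply: (lt_trans aj); rewrite pmulr_rlt0 //; lra.
rewrite ltr0_norm // mulrAC ler_pdivrMr //.
by move: aj; nra.
Qed.

End Clusters.

Lemma cluster_growth : cluster_condition a ->
  exists M : nat, (0 < M)%N /\ exists2 c : R, 0 < c & forall j : int,
    c * ln (2 + `|j|%N%:R) ^+ 2 <= a (j + M%:Z) - a j.
Proof.
move=> [d [m [b]]] /= [d0 [ran m0 bin bnext _] [M mM] _ [rpos rneg]].
have M0 : (0 < M)%N by exact: leq_trans (m0 0) (mM 0).
exists M; split => //.
apply: (@gap_of_ratio _ (d / (1 + d))) => //; first by rewrite divr_gt0 ?addr_gt0.
apply: (@cluster_ratio d m b) => // k.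
have : range a (a k) by exists k.
by rewrite ran => -[p _ [j /= jm <-]]; exists (p, j).
Qed.

End LogGrowth.

(** * Riemann sums along a ray *)

Section RaySums.
Variables (R : realType) (U : nat -> R) (Q : R).
Hypothesis U_gt0 : forall j, 0 < U j.
Hypothesis U_incr : forall j, U j <= U j.+1.
Hypothesis U_growth : forall j, U j.+1 <= Q * U j.

Let Q_ge1 : 1 <= Q.
Proof.
have := le_trans (U_incr 0) (U_growth 0); have := U_gt0 0.
by move=> u0; rewrite ler_pMl.
Qed.

(** Since the ratios U_(j+1) / U_j are bounded, the terms are at most Q times the
    increments of - 1 / U. *)
Lemma ray_inv2 L : \sum_(j < L) (U j.+1 - U j) / U j ^+ 2 <= Q / U 0.
Proof.
suff H : \sum_(j < L) (U j.+1 - U j) / U j ^+ 2 <= Q / U 0 - Q / U L.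
  by apply: le_trans H _; rewrite gerBl divr_ge0 ?(ltW (U_gt0 _)) // (le_trans _ Q_ge1).
elim: L => [|L IHL]; first by rewrite big_ord0 subrr.
rewrite big_ord_recr /=.
have u := U_gt0 L; have u' := U_gt0 L.+1.
have step : (U L.+1 - U L) / U L ^+ 2 <= Q / U L - Q / U L.+1.
  rewrite ler_pdivrMr ?exprn_gt0 //.
  have -> : (Q / U L - Q / U L.+1) * U L ^+ 2 =
      (U L.+1 - U L) * (Q * U L / U L.+1) by field; rewrite !gt_eqF.
  by rewrite ler_peMr ?subr_ge0 // ler_pdivlMr // mul1r.
by move: IHL step; lra.
Qed.

End RaySums.

Section RaySquares.
Variables (R : realType) (U : nat -> R) (Q A B : R).
Hypothesis U_gt0 : forall j, 0 < U j.
Hypothesis U_incr : forall j, U j <= U j.+1.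
Hypothesis U_growth : forall j, U j.+1 <= Q * U j.
Hypothesis B_ge0 : 0 <= B.
Hypothesis U_step : forall j, U j.+1 - U j <= B * (A + Num.sqrt (U j)).

(** The same comparison, applied to the square roots of the U_j. *)
Lemma ray_inv32 L : \sum_(j < L) (U j.+1 - U j) * Num.sqrt (U j) / U j ^+ 2
  <= 2 * Q ^+ 2 / Num.sqrt (U 0).
Proof.
have Q1 : 1 <= Q.
  by have := le_trans (U_incr 0) (U_growth 0); have u0 := U_gt0 0; rewrite ler_pMl.
pose Y j := Num.sqrt (U j).
have Y0 j : 0 < Y j by rewrite sqrtr_gt0.
have YE j : U j = Y j ^+ 2 by rewrite /Y sqr_sqrtr // ltW.
have Yi j : Y j <= Y j.+1 by rewrite ler_wsqrtr.
have Yg j : Y j.+1 <= Q * Y j.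
  rewrite -(@ler_pXn2r _ 2) ?nnegrE ?mulr_ge0 ?(ltW (Y0 _)) //; last lra.
  rewrite exprMn -!YE; apply: le_trans (U_growth j) _.
  by rewrite ler_wpM2r ?(ltW (U_gt0 _)) // expr2 ler_peMl //; lra.
apply: (@le_trans _ _ (2 * Q * (Q / Y 0))); last by rewrite expr2 !mulrA.
apply: le_trans (ler_wpM2l _ (ray_inv2 Y0 Yi Yg L)); last lra.
rewrite mulr_sumr; apply: ler_sum => j _; rewrite -/(Y j) !YE.
have y := Y0 j; have yi := Yi j; have yg := Yg j.
have -> : (Y j.+1 ^+ 2 - Y j ^+ 2) * Y j / (Y j ^+ 2) ^+ 2 =
  (Y j.+1 + Y j) / Y j * ((Y j.+1 - Y j) / Y j ^+ 2) by field; rewrite gt_eqF.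
rewrite ler_wpM2r ?divr_ge0 ?subr_ge0 ?sqr_ge0 //.
by rewrite ler_pdivrMr //; nra.
Qed.

(** One of the two factors U_(j+1) - U_j is bounded by the hypothesis on steps, the
    other one is kept for comparison with an integral. *)
Lemma ray_squares L : \sum_(j < L) (U j.+1 - U j) ^+ 2 / U j ^+ 2 <=
  B * (`|A| * (Q / U 0) + 2 * Q ^+ 2 / Num.sqrt (U 0)).
Proof.
apply: (@le_trans _ _ (B * (`|A| * (\sum_(j < L) (U j.+1 - U j) / U j ^+ 2) +
   \sum_(j < L) (U j.+1 - U j) * Num.sqrt (U j) / U j ^+ 2))); last first.
  rewrite ler_wpM2l // lerD //; last exact: ray_inv32.
  by rewrite ler_wpM2l // ray_inv2.
rewrite mulr_sumr -big_split mulr_sumr; apply: ler_sum => j _ /=.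
have u := U_gt0 j; have d0 : 0 <= U j.+1 - U j by rewrite subr_ge0.
rewrite mulrA -mulrDl mulrA ler_wpM2r ?invr_ge0 ?sqr_ge0 //.
have -> : B * (`|A| * (U j.+1 - U j) + (U j.+1 - U j) * Num.sqrt (U j)) =
  (U j.+1 - U j) * (B * (`|A| + Num.sqrt (U j))) by ring.
rewrite expr2 ler_wpM2l //; apply: le_trans (U_step j) _.
by rewrite ler_wpM2l // lerD2r ler_norm.
Qed.

End RaySquares.

Section RayLogarithms.
Variables (R : realType) (U : nat -> R).
Hypothesis U_gt0 : forall j, 0 < U j.
Hypothesis U_incr : forall j, U j <= U j.+1.

Lemma log_increment (u v : R) : 0 < u -> u <= v ->
  (v - u) / v <= ln v - ln u <= (v - u) / u.
Proof.
move=> u0 uv; have v0 : 0 < v by apply: lt_le_trans uv.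
have h (x y : R) : 0 < x -> 0 < y -> ln x - ln y <= (x - y) / y.
  move=> x0 y0; rewrite -ln_div ?posrE // mulrBl divff ?gt_eqF //.
  by apply: ln_le_subr1; rewrite divr_gt0.
rewrite h // andbT -[leRHS]opprB; have := h u v u0 v0.
rewrite -lerN2; congr (_ <= _); rewrite -mulNr opprB //.
Qed.

(** Left and right Riemann sums of 1 / u enclose the increment of the logarithm, and
    on each interval they differ by at most the square of its relative length. *)
Lemma ray_log L :
  (`|\sum_(j < L) (U j.+1 - U j) / U j - (ln (U L) - ln (U 0))| <=
    \sum_(j < L) (U j.+1 - U j) ^+ 2 / U j ^+ 2) /\
  (`|\sum_(j < L) (U j.+1 - U j) / U j.+1 - (ln (U L) - ln (U 0))| <=
    \sum_(j < L) (U j.+1 - U j) ^+ 2 / U j ^+ 2).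
Proof.
have -> : ln (U L) - ln (U 0) = \sum_(j < L) (ln (U j.+1) - ln (U j)).
  elim: L => [|L IHL]; first by rewrite big_ord0 subrr.
  by rewrite big_ord_recr /= -IHL; ring.
have main j : (U j.+1 - U j) / U j - (U j.+1 - U j) / U j.+1 <=
    (U j.+1 - U j) ^+ 2 / U j ^+ 2.
  have u := U_gt0 j; have v := U_gt0 j.+1.
  have -> : (U j.+1 - U j) / U j - (U j.+1 - U j) / U j.+1 =
    (U j.+1 - U j) ^+ 2 * (U j * U j.+1)^-1 by field; rewrite !gt_eqF.
  rewrite ler_wpM2l ?sqr_ge0 // lef_pV2 ?posrE ?mulr_gt0 ?exprn_gt0 // expr2.
  by rewrite ler_pM2l.
by split; rewrite -sumrB; apply: le_trans (ler_norm_sum _ _ _) _;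
  apply: ler_sum => j _; have := main j;
  have /andP[] := log_increment (U_gt0 j) (U_incr j);
  rewrite ler_norml => h1 h2 h3; apply/andP; split; lra.
Qed.

End RayLogarithms.

(** * Weights equal to the gaps *)

Definition step_weight {R : realType} (a : int -> R) (k : int) : R :=
  a (k + 1) - a k.

Lemma step_weight_ge (R : realType) (a : int -> R) (delta : R) :
  {homo a : n m / n < m} -> (forall n m : int, n != m -> delta < `|a n - a m|) ->
  forall k, delta <= step_weight a k.
Proof.
move=> a_incr a_sep k.
have : delta < `|a (k + 1) - a k| by apply: a_sep; apply/eqP; lia.
by rewrite gtr0_norm ?subr_gt0 ?a_incr //; [exact: ltW|lia].
Qed.

Lemma absz_bounds (p q : int) (N : nat) : (absz p + absz q <= N)%N ->
  p <= N%:Z /\ - N%:Z <= q.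
Proof. by lia. Qed.

Section GapWeights.
Variables (R : realType) (a : int -> R) (delta C : R).
Hypothesis a_incr : {homo a : n m / n < m}.
Hypothesis delta_gt0 : 0 < delta.
Hypothesis a_sep : forall n m : int, n != m -> delta < `|a n - a m|.

Let w := step_weight a.

Hypothesis C_ge1 : 1 <= C.
Hypothesis w_reg : forall k : int, w (k + 1) <= C * w k /\ w k <= C * w (k + 1).
Let w_ge k : delta <= w k. Proof. exact: step_weight_ge. Qed.

Let w_gt0 k : 0 < w k. Proof. exact: lt_le_trans (w_ge k). Qed.

Let C_ge0 : 0 <= C. Proof. exact: le_trans C_ge1. Qed.

Let Q := 1 + C.

Let rdist n (j : nat) := a (n + 1 + j%:Z) - a n.
Let ldist n (j : nat) := a n - a (n - 1 - j%:Z).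

Let rdist_step n j : rdist n j.+1 - rdist n j = w (n + 1 + j%:Z).
Proof.
rewrite /rdist /w /step_weight.
have -> : n + 1 + j.+1%:Z = n + 1 + j%:Z + 1 by lia.
ring.
Qed.

Let ldist_step n j : ldist n j.+1 - ldist n j = w (n - 2 - j%:Z).
Proof.
rewrite /ldist /w /step_weight.
have -> : n - 1 - j.+1%:Z = n - 2 - j%:Z by lia.
have -> : n - 2 - j%:Z + 1 = n - 1 - j%:Z by lia.
ring.
Qed.

Let rdist0 n : rdist n 0 = w n.
Proof. by rewrite /rdist addr0. Qed.

Let ldist0 n : ldist n 0 = w (n - 1).
Proof. by rewrite /ldist subr0 /w /step_weight subrK. Qed.

Let rdist_incr n j : rdist n j <= rdist n j.+1.
Proof. by rewrite -subr_ge0 rdist_step ltW. Qed.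

Let ldist_incr n j : ldist n j <= ldist n j.+1.
Proof. by rewrite -subr_ge0 ldist_step ltW. Qed.

Let rdist_gt0 n j : 0 < rdist n j.
Proof. by rewrite subr_gt0; apply: a_incr; lia. Qed.

Let ldist_gt0 n j : 0 < ldist n j.
Proof. by rewrite subr_gt0; apply: a_incr; lia. Qed.

Let rdist_growth n j : rdist n j.+1 <= Q * rdist n j.
Proof.
have h : w (n + j%:Z) <= rdist n j.
  rewrite /rdist /w /step_weight.
  have -> : n + 1 + j%:Z = n + j%:Z + 1 by lia.
  by rewrite lerD2l lerN2; apply: (incr_le a_incr); lia.
have [+ _] := w_reg (n + j%:Z).
have -> : n + j%:Z + 1 = n + 1 + j%:Z by lia.
have : C * w (n + j%:Z) <= C * rdist n j by rewrite ler_wpM2l.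
by have := rdist_step n j; rewrite /Q mulrDl mul1r; lra.
Qed.

Let ldist_growth n j : ldist n j.+1 <= Q * ldist n j.
Proof.
have h : w (n - 1 - j%:Z) <= ldist n j.
  rewrite /ldist /w /step_weight.
  by rewrite lerD2r; apply: (incr_le a_incr); lia.
have [_] := w_reg (n - 2 - j%:Z).
have -> : n - 2 - j%:Z + 1 = n - 1 - j%:Z by lia.
have : C * w (n - 1 - j%:Z) <= C * ldist n j by rewrite ler_wpM2l.
by have := ldist_step n j; rewrite /Q mulrDl mul1r; lra.
Qed.

Let w_inv k : (w k)^-1 <= delta^-1.
Proof. by rewrite lef_pV2 ?posrE. Qed.

Let Q_gt0 : 0 < Q. Proof. by rewrite addr_gt0 // (lt_le_trans _ C_ge1). Qed.

Let Q_ge1 : 1 <= Q. Proof. by rewrite lerDl. Qed.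

(** To the right of a_n the terms are exactly those of [ray_inv2].  To the left the
    gap w_k lies between a_k and a_n, and is compared with w_(k-1) by regularity. *)
Lemma step_weight_square_sum n N : psum (fun k => w k / (a k - a n) ^+ 2) N <=
  C * (Q * delta^-1) + Q * delta^-1.
Proof.
have := @psum_le_rays _ (fun k => w k / (a k - a n) ^+ 2) n (C * (Q * delta^-1)) (Q * delta^-1).
rewrite subrr expr0n /= invr0 mulr0 addr0; apply.
- by move=> k; rewrite divr_ge0 ?sqr_ge0 // ltW.
- move=> L; apply: (@le_trans _ _ (C * (\sum_(j < L)
      (ldist n j.+1 - ldist n j) / ldist n j ^+ 2))).
    rewrite mulr_sumr; apply: ler_sum => j _; rewrite mulrA -sqrrN opprB.
    rewrite ler_wpM2r ?invr_ge0 ?sqr_ge0 // ldist_step.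
    have [+ _] := w_reg (n - 2 - j%:Z).
    by have -> : n - 2 - j%:Z + 1 = n - 1 - j%:Z by lia.
  rewrite ler_wpM2l //.
  apply: le_trans (ray_inv2 (ldist_gt0 n) (ldist_incr n) (ldist_growth n) L) _.
  by rewrite ldist0 ler_wpM2l // ltW.
- move=> L; apply: (@le_trans _ _ (\sum_(j < L)
      (rdist n j.+1 - rdist n j) / rdist n j ^+ 2)).
    by apply: ler_sum => j _; rewrite rdist_step.
  apply: le_trans (ray_inv2 (rdist_gt0 n) (rdist_incr n) (rdist_growth n) L) _.
  by rewrite rdist0 ler_wpM2l // ltW.
Qed.

Section Balance.
Variable B : R.
Hypothesis B_ge0 : 0 <= B.
(** This bounds the gaps near a_n by the power 3/2 of w_n, and the distant gaps by
    the square root of the distance.  Then the squares of the relative lengths of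
    the gaps seen from a_n sum up to O(sqrt w_n), the order of magnitude that
    [derive_bound] tolerates for the regular part at a pole of weight w_n. *)
Hypothesis w_dominated : forall n k,
  w k <= B * (w n * Num.sqrt (w n) + Num.sqrt `|a k - a n|).

Let sw n := Num.sqrt (w n).

Let sw_gt0 n : 0 < sw n. Proof. by rewrite sqrtr_gt0. Qed.

Let one_le_sw n : 1 <= (Num.sqrt delta)^-1 * sw n.
Proof.
have d0 : 0 < Num.sqrt delta by rewrite sqrtr_gt0.
by rewrite mulrC ler_pdivlMr // mul1r ler_wsqrtr.
Qed.

Let ray_const := B * Q * (C * Q + 2 * Q ^+ 2 * (Num.sqrt delta)^-1 ^+ 2).

Let ray_const_ge0 : 0 <= ray_const.
Proof.
by rewrite /ray_const !(mulr_ge0, addr_ge0, sqr_ge0, invr_ge0, sqrtr_ge0, ltW Q_gt0).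
Qed.

Let const_le_sw x n : 0 <= x -> x <= x * (Num.sqrt delta)^-1 * sw n.
Proof. by move=> x0; rewrite -mulrA ler_peMr // one_le_sw. Qed.

Let sw_cube n : `|w n * sw n| = w n * sw n.
Proof. by rewrite ger0_norm // mulr_ge0 ?sqrtr_ge0 ?ltW. Qed.

Let squares_bound n v (Bq : R) : 0 <= Bq -> Bq <= B * Q -> delta <= v -> w n <= C * v ->
  Bq * (`|w n * sw n| * (Q / v) + 2 * Q ^+ 2 / Num.sqrt v) <= ray_const * sw n.
Proof.
move=> Bq0 BqQ dv wv; have v0 : 0 < v by apply: lt_le_trans dv.
rewrite /ray_const -[leRHS]mulrA; apply: ler_pM => //.
  by apply: addr_ge0; apply: mulr_ge0;
    rewrite ?divr_ge0 ?invr_ge0 ?sqrtr_ge0 ?mulr_ge0 ?sqr_ge0 ?(ltW Q_gt0) ?(ltW v0).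
rewrite [leRHS]mulrDl; apply: lerD.
  rewrite sw_cube mulrA ler_pdivrMr //.
  have -> : C * Q * sw n * v = Q * sw n * (C * v) by ring.
  have -> : w n * sw n * Q = Q * sw n * w n by ring.
  by rewrite ler_wpM2l // mulr_ge0 ?sqrtr_ge0 // ltW.
rewrite -!mulrA ler_wpM2l // !ler_wpM2l ?(ltW Q_gt0) //.
apply: (@le_trans _ _ ((Num.sqrt delta)^-1)).
  by rewrite lef_pV2 ?posrE ?sqrtr_gt0 // ler_wsqrtr.
by rewrite ler_peMr ?invr_ge0 ?sqrtr_ge0 // one_le_sw.
Qed.

Lemma rsquares n L : \sum_(j < L) (rdist n j.+1 - rdist n j) ^+ 2 / rdist n j ^+ 2 <=
  ray_const * sw n.
Proof.
have st j : rdist n j.+1 - rdist n j <= B * (w n * sw n + Num.sqrt (rdist n j)).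
  rewrite rdist_step; apply: le_trans (w_dominated n _) _.
  by rewrite ger0_norm // ltW // rdist_gt0.
apply: le_trans (ray_squares (rdist_gt0 n) (rdist_incr n) (rdist_growth n) B_ge0 st L) _.
rewrite rdist0; apply: squares_bound => //.
  by rewrite ler_peMr.
by rewrite ler_peMl // ltW.
Qed.

Lemma lsquares n L : \sum_(j < L) (ldist n j.+1 - ldist n j) ^+ 2 / ldist n j ^+ 2 <=
  ray_const * sw n.
Proof.
have BQ : 0 <= B * Q by rewrite mulr_ge0 // ltW.
have st j : ldist n j.+1 - ldist n j <= B * Q * (w n * sw n + Num.sqrt (ldist n j)).
  rewrite ldist_step; apply: le_trans (w_dominated n _) _.
  have -> : `|a (n - 2 - j%:Z) - a n| = ldist n j.+1.
    have -> : n - 2 - j%:Z = n - 1 - j.+1%:Z by lia.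
    by rewrite distrC ger0_norm // ltW // ldist_gt0.
  rewrite -mulrA ler_wpM2l // mulrDr lerD //.
    by rewrite ler_peMl // mulr_ge0 ?sqrtr_ge0 // ltW.
  have l0 := ltW (ldist_gt0 n j).
  apply: (@le_trans _ _ (Num.sqrt (Q ^+ 2 * ldist n j))).
    rewrite ler_wsqrtr //; apply: le_trans (ldist_growth n j) _.
    by rewrite ler_wpM2r // expr2 ler_peMl // ltW.
  by rewrite sqrtrM ?sqr_ge0 // sqrtr_sqr ger0_norm // ltW.
apply: le_trans (ray_squares (ldist_gt0 n) (ldist_incr n) (ldist_growth n) BQ st L) _.
rewrite ldist0; apply: squares_bound => //.
by have [+ _] := w_reg (n - 1); rewrite subrK.
Qed.

Let pole_sum n x k := w k * (if k == n then 0 else (a k - x)^-1).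

(** For large N the outer logarithms at x differ from these ones by at most 2 ln 2,
    and these, being independent of x, cancel between the sum at x and the
    compensating sum at a_0. *)
Let end_logs (N : nat) := ln (a N%:Z) - ln (- a (- N%:Z)).

(** The sum is a Riemann sum for the integral of 1 / (t - x).  By [ray_log] each of
    the two rays from x contributes the difference of the logarithms of the
    distances at its ends, with opposite signs.  The inner ends contribute O(1), by
    regularity of the gaps next to a_n, which is the vanishing of the principal
    value; the outer ends are kept. *)
Lemma pole_sum_log n x (N : nat) : (`|n| + 1 < N)%N -> nearest a n x ->
  `|psum (pole_sum n x) N - (ln (a N%:Z - x) - ln (x - a (- N%:Z)))| <=
  8 * ray_const * sw n + ln (2 * Q) + 2.
Proof.
move=> nN nx.
have n1 : n - 1 != n by apply/eqP; lia.
have nr (j : nat) : n + 1 + j%:Z != n by apply/eqP; lia.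
have nl (j : nat) : n - 2 - j%:Z != n by apply/eqP; lia.
have nb (j : nat) : n - 1 - (bump 0 j)%:Z = n - 2 - j%:Z by rewrite /bump; lia.
have nb' (j : nat) : n - 1 - j.+1%:Z = n - 2 - j%:Z by lia.
have [L LE] : exists L : nat, L.+1%:Z = N%:Z + n.
  by exists (absz (N%:Z + n)%R).-1; lia.
have [M ME] : exists M : nat, M%:Z = N%:Z - n - 1.
  by exists (absz (N%:Z - n - 1)%R); lia.
have EM : n + 1 + M%:Z = N%:Z by lia.
have EL : n - 1 - L%:Z = - N%:Z by lia.
have near_k k : `|a k - a n| <= 2 * `|a k - x| by exact: nearest_dist.
have xl : a (n - 1) < x.
  rewrite ltNge; apply/negP => xa; have := nx (n - 1).
  have : a (n - 1) < a n by apply: a_incr; rewrite gtrBl.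
  by move=> h; rewrite !ler0_norm; lra.
have xr : x < a (n + 1).
  rewrite ltNge; apply/negP => xa; have := nx (n + 1).
  have : a n < a (n + 1) by apply: a_incr; rewrite ltrDl.
  by move=> h; rewrite !ger0_norm; lra.
pose U (j : nat) := a (n + 1 + j%:Z) - x.
pose V (j : nat) := x - a (n - 1 - j%:Z).
have U0 j : 0 < U j.
  by rewrite subr_gt0; apply: lt_le_trans xr _; apply: (incr_le a_incr); rewrite lerDl.
have V0 j : 0 < V j.
  by rewrite subr_gt0; apply: le_lt_trans xl; apply: (incr_le a_incr); rewrite gerBl.
have dU j : U j.+1 - U j = rdist n j.+1 - rdist n j by rewrite /U /rdist; ring.
have dV j : V j.+1 - V j = ldist n j.+1 - ldist n j by rewrite /V /ldist; ring.
have Ui j : U j <= U j.+1 by rewrite -subr_ge0 dU subr_ge0.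
have Vi j : V j <= V j.+1 by rewrite -subr_ge0 dV subr_ge0.
have rU j : rdist n j <= 2 * U j.
  have := near_k (n + 1 + j%:Z); rewrite [`|_ - a n|]ger0_norm; last exact: ltW (rdist_gt0 n j).
  by rewrite ger0_norm // ltW // U0.
have lV j : ldist n j <= 2 * V j.
  have := near_k (n - 1 - j%:Z); rewrite [`|_ - a n|]distrC ger0_norm; last exact: ltW (ldist_gt0 n j).
  by rewrite distrC ger0_norm // ltW // V0.
have sqU (W Z : nat -> R) p : (forall j, 0 < W j) -> (forall j, W j <= 2 * Z j) ->
    (forall j, Z j.+1 - Z j = W j.+1 - W j) ->
    \sum_(j < p) (Z j.+1 - Z j) ^+ 2 / Z j ^+ 2 <=
    4 * \sum_(j < p) (W j.+1 - W j) ^+ 2 / W j ^+ 2.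
  move=> W0 WZ dZ; rewrite mulr_sumr; apply: ler_sum => j _; rewrite dZ mulrCA.
  rewrite ler_wpM2l ?sqr_ge0 //; have z0 : 0 < Z j by have := W0 j; have := WZ j; lra.
  rewrite ler_pdivlMr ?exprn_gt0 // mulrC ler_pdivrMr ?exprn_gt0 //.
  have -> : 4 * Z j ^+ 2 = (2 * Z j) ^+ 2 by rewrite exprMn; ring.
  by rewrite lerXn2r ?nnegrE ?WZ ?mulr_ge0 // ltW.
rewrite (psum_rays _ LE ME) big_ord_recl /=.
have -> : pole_sum n x n = 0 by rewrite /pole_sum eqxx mulr0.
have rightE : \sum_(j < M) pole_sum n x (n + 1 + j%:Z) = \sum_(j < M) (U j.+1 - U j) / U j.
  apply: eq_bigr => j _; rewrite dU rdist_step /pole_sum ifN //.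
have leftE : \sum_(i < L) pole_sum n x (n - 1 - (bump 0 i)%:Z) =
    - \sum_(j < L) (V j.+1 - V j) / V j.+1.
  rewrite -sumrN; apply: eq_bigr => j _; rewrite dV ldist_step nb /pole_sum ifN //.
  have -> : a (n - 2 - j%:Z) - x = - V j.+1 by rewrite /V nb' opprB.
  by rewrite invrN mulrN.
have firstE : pole_sum n x (n - 1 - 0) = - (w (n - 1) / V 0%N).
  rewrite subr0 /pole_sum ifN //.
  by rewrite /V subr0 -mulrN -[X in _ = _ * X]invrN opprB.
rewrite rightE leftE firstE.
have first2 : w (n - 1) / V 0%N <= 2.
  by rewrite ler_pdivrMr //; have := lV 0%N; rewrite ldist0.
have first0 : 0 <= w (n - 1) / V 0%N by rewrite divr_ge0 // ltW.
have [RU _] := ray_log U0 Ui M; have [_ RV] := ray_log V0 Vi L.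
have eU := le_trans RU (sqU _ _ M (rdist_gt0 n) rU dU).
have eV := le_trans RV (sqU _ _ L (ldist_gt0 n) lV dV).
have bU := rsquares n M; have bV := lsquares n L.
have UM : U M = a N%:Z - x by rewrite /U EM.
have VL : V L = x - a (- N%:Z) by rewrite /V EL.
rewrite UM in eU; rewrite VL in eV.
have ratio (p q : R) : 0 < p -> 0 < q -> p <= 2 * Q * q -> ln p - ln q <= ln (2 * Q).
  move=> p0 q0 pq; rewrite -ln_div ?posrE //; apply: le_ln; first exact: divr_gt0.
  by rewrite ler_pdivrMr.
have UV : U 0%N + V 0%N = w n + w (n - 1).
  by rewrite /U /V /w /step_weight addr0 subr0 subrK; ring.
have rU0 := rU 0%N; have lV0 := lV 0%N; rewrite rdist0 in rU0; rewrite ldist0 in lV0.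
have u0 := U0 0%N; have v0 := V0 0%N.
have [r1 r2] := w_reg (n - 1); rewrite subrK in r1 r2.
have h1 : ln (U 0%N) - ln (V 0%N) <= ln (2 * Q).
  apply: ratio => //; rewrite /Q.
  have : C * w (n - 1) <= C * (2 * V 0%N) by rewrite ler_wpM2l.
  by have := w_gt0 n; have := w_gt0 (n - 1); lra.
have h2 : ln (V 0%N) - ln (U 0%N) <= ln (2 * Q).
  apply: ratio => //; rewrite /Q.
  have : C * w n <= C * (2 * U 0%N) by rewrite ler_wpM2l.
  by have := w_gt0 n; have := w_gt0 (n - 1); lra.
move: eU eV bU bV first2 first0 h1 h2.
set sU := \sum_(j < M) _ / U j; set sV := \sum_(j < L) _ / V j.+1.
set qU := \sum_(j < M) _; set qV := \sum_(j < L) _; set f0 := _ / V 0%N.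
set K0 := ray_const * sw n; rewrite -mulrA -/K0.
rewrite !ler_norml => /andP[e1 e2] /andP[e3 e4] *.
by apply/andP; split; lra.
Qed.

Hypothesis a_pinf : forall A, exists n, A <= a n.
Hypothesis a_ninf : forall A, exists n, a n <= A.

Lemma end_logs_near x : \forall N \near \oo,
  `|ln (a N%:Z - x) - ln (x - a (- N%:Z)) - end_logs N| <= 2 * ln 2.
Proof.
have [p pP] := a_pinf (2 * `|x| + 1); have [q qP] := a_ninf (- (2 * `|x| + 1)).
apply: filterS (nbhs_infty_ge (absz p + absz q)%N) => N /= pqN.
have [pN qN] := absz_bounds pqN.
have aN : 2 * `|x| + 1 <= a N%:Z by apply: (le_trans pP); exact: (incr_le a_incr).
have aNN : a (- N%:Z) <= - (2 * `|x| + 1) by apply: le_trans qP; exact: (incr_le a_incr).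
have xx := ler_norm x; have xx' := ler_norm (- x); rewrite normrN in xx'.
have x0 := normr_ge0 x.
have ratio (u v : R) : 0 < u -> 0 < v -> u <= 2 * v -> ln u - ln v <= ln 2.
  move=> u0 v0 uv; rewrite -ln_div ?posrE //; apply: le_ln; first exact: divr_gt0.
  by rewrite ler_pdivrMr.
rewrite /end_logs; set u := a N%:Z in aN *; set v := a (- N%:Z) in aNN *.
have h1 : ln (u - x) - ln u <= ln 2 by apply: ratio; lra.
have h2 : ln u - ln (u - x) <= ln 2 by apply: ratio; lra.
have h3 : ln (x - v) - ln (- v) <= ln 2 by apply: ratio; lra.
have h4 : ln (- v) - ln (x - v) <= ln 2 by apply: ratio; lra.
by rewrite ler_norml; apply/andP; split; lra.
Qed.

Lemma step_weight_balance : exists2 P : R, 0 <= P & forall n x, nearest a n x ->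
  \forall N \near \oo,
  `|psum (fun k => w k * ((if k == n then 0 else (a k - x)^-1) - (a k - a 0)^-1)) N|
    <= P * sw n.
Proof.
pose c0 := ln (2 * Q) + 2 + 2 * ln 2.
have l2 : 0 <= ln 2 :> R by apply: ln_ge0; lra.
have lQ : 0 <= ln (2 * Q) by apply: ln_ge0; move: Q_ge1; lra.
have c00 : 0 <= c0 by rewrite /c0; lra.
pose e0 := 8 * ray_const * sw 0 + 2 * c0.
have e00 : 0 <= e0.
  apply: addr_ge0; last exact: mulr_ge0.
  apply: mulr_ge0; last exact: ltW.
  by apply: mulr_ge0; [|exact: ray_const_ge0].
exists (8 * ray_const + e0 * (Num.sqrt delta)^-1).
  apply: addr_ge0; first by apply: mulr_ge0; [|exact: ray_const_ge0].
  by apply: mulr_ge0; rewrite ?invr_ge0 ?sqrtr_ge0.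
move=> n x nx; have n0 : nearest a 0 (a 0) by move=> k; rewrite subrr normr0.
have large := nbhs_infty_gt (absz n + 1).
apply: filterS (filterI large (filterI (end_logs_near x) (end_logs_near (a 0)))).
move=> N [/= nN [h3 h4]]; have zN : (absz 0 + 1 < N)%N.
  by apply: leq_ltn_trans nN; rewrite leq_add2r.
have h1 := pole_sum_log nN nx; have h2 := pole_sum_log zN n0.
have -> : psum (fun k => w k * ((if k == n then 0 else (a k - x)^-1) - (a k - a 0)^-1)) N
   = psum (pole_sum n x) N - psum (pole_sum 0 (a 0)) N.
  rewrite -psumB; apply: eq_psum => k; rewrite /pole_sum mulrBr; congr (_ - _ * _).
  by case: eqP => // ->; rewrite subrr invr0.
have h5 := const_le_sw n e00; rewrite mulrDl.
move: h1 h2 h3 h4 h5; rewrite /e0 /c0 !ler_norml.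
set p1 := psum _ N; set p2 := psum _ N.
set g1 := ln (a _ - x) - _; set g2 := ln (a _ - a 0) - _.
move=> /andP[? ?] /andP[? ?] /andP[? ?] /andP[? ?] ?.
by apply/andP; split; lra.
Qed.

End Balance.

End GapWeights.

(** * Logarithmic gaps *)

Section Regimes.
Variable R : realType.

Lemma ler_dist_between (x y z : R) : (x <= y <= z) || (z <= y <= x) ->
  `|x - y| <= `|x - z|.
Proof.
case/orP=> /andP[h1 h2]; first by rewrite !ler0_norm; lra.
by rewrite !ger0_norm; lra.
Qed.

Definition shifted_ln (y : R) : R := ln (2 + `|y|).

Lemma shifted_ln_ge y : ln 2 <= shifted_ln y.
Proof. by apply: le_ln => //; rewrite lerDl. Qed.

Lemma ln2_gt0 : 0 < ln 2 :> R.
Proof. by apply: ln_gt0; lra. Qed.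

Lemma shifted_ln_gt0 y : 0 < shifted_ln y.
Proof. exact: lt_le_trans ln2_gt0 (shifted_ln_ge y). Qed.

Lemma shifted_ln_sub x y : shifted_ln y <= shifted_ln x + 2 * Num.sqrt `|y - x|.
Proof.
pose s := Num.sqrt `|y - x|; have s0 : 0 <= s by exact: sqrtr_ge0.
have sE : s ^+ 2 = `|y - x| by rewrite /s sqr_sqrtr.
have x0 := normr_ge0 x.
have h1 : shifted_ln y <= ln ((2 + `|x|) * (1 + s) ^+ 2).
  apply: le_ln; first by have := normr_ge0 y; lra.
  have := ler_normD (y - x) x; rewrite subrK -sE; nra.
have p : 0 < 1 + s by lra.
have q : 0 < 2 + `|x| by lra.
apply: le_trans h1 _; rewrite lnM ?posrE ?exprn_gt0 //.
rewrite lerD2l lnXn //.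
have s1 : -1 < s by lra.
by rewrite mulr2n -/s; have := le_ln1Dx s1; lra.
Qed.

(** As long as E_i exceeds e, its iterated logarithm is positive and the lower bound
    on E_i is effective; it forces E_i to infinity together with l_i.  When E_i is at
    most e the iterated logarithm is negative and the bound is void.  A sequence
    with bounded ratios E_(i+1) / E_i that has once been at most e cannot jump to
    the first regime, so one of the two regimes holds from some index on. *)
Lemma regular_dichotomy (E l : nat -> R) (C c : R) : 1 <= C -> 0 <= c ->
  (forall i, 0 < E i) -> (forall i, E i.+1 <= C * E i) ->
  (forall A, exists N, forall i, (N <= i)%N -> A <= l i) ->
  (exists N, forall i, (N <= i)%N ->
    [/\ 1 < E i, ln (ln (E i)) != 0 & l i / ln (ln (E i)) <= c * E i]) ->
  (exists N, forall i, (N <= i)%N -> l i <= 2 * c * (E i * Num.sqrt (E i))) \/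
  (exists N, forall i, (N <= i)%N -> E i <= expR 1).
Proof.
move=> C1 c0 E0 EC linf [N0 HN0].
have ee : 0 < expR 1 :> R by exact: expR_gt0.
pose T := C * expR 1.
have T0 : 0 < T by rewrite mulr_gt0 //; lra.
have [N1 HN1] := linf (2 * c * (T * Num.sqrt T) + 1).
have alt i : (N0 <= i)%N -> E i <= expR 1 \/ l i <= 2 * c * (E i * Num.sqrt (E i)).
  move=> /HN0[E1 lne h]; have [le|lt] := leP (E i) (expR 1); first by left.
  right; have lE1 : 1 < ln (E i).
    by rewrite -(expRK (1 : R)) ltr_ln ?posrE.
  have ll0 : 0 < ln (ln (E i)) by exact: ln_gt0.
  move: h; rewrite ler_pdivrMr // => h; apply: le_trans h _.
  have s0 : 0 < Num.sqrt (E i) by rewrite sqrtr_gt0.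
  have sE : Num.sqrt (E i) ^+ 2 = E i by rewrite sqr_sqrtr // ltW.
  have h1 : ln (E i) <= 2 * Num.sqrt (E i).
    rewrite -{1}sE lnXn // mulr_natl lerMn2r /=.
    by apply: ltW; exact: ln_sublinear.
  have h2 : ln (ln (E i)) <= ln (E i) by apply/ltW/ln_sublinear; lra.
  have -> : 2 * c * (E i * Num.sqrt (E i)) = c * E i * (2 * Num.sqrt (E i)) by ring.
  by rewrite ler_wpM2l ?mulr_ge0 ?(ltW (E0 i)) // (le_trans h2).
have [[n [nN En]]|none] := pselect (exists n, (maxn N0 N1 <= n)%N /\ E n <= expR 1).
  right; exists n => i /subnK <-; elim: (i - n)%N => [//|j IHj].
  rewrite addSn; have jn : (maxn N0 N1 <= (j + n).+1)%N.
    by apply: leq_trans nN _; rewrite -addSn leq_addl.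
  have [//|h] := alt (j + n).+1 (leq_trans (leq_maxl _ _) jn).
  have l1 := HN1 _ (leq_trans (leq_maxr _ _) jn).
  have ET : E (j + n).+1 <= T.
    by apply: le_trans (EC _) _; rewrite /T ler_wpM2l //; lra.
  have h2 : E (j + n).+1 * Num.sqrt (E (j + n).+1) <= T * Num.sqrt T.
    by apply: ler_pM; rewrite ?sqrtr_ge0 ?ler_wsqrtr // ltW.
  have : 2 * c * (E (j + n).+1 * Num.sqrt (E (j + n).+1)) <= 2 * c * (T * Num.sqrt T).
    by rewrite ler_wpM2l // mulr_ge0.
  by move: h l1; lra.
left; exists (maxn N0 N1) => i iN.
have [h|//] := alt i (leq_trans (leq_maxl _ _) iN).
by exfalso; apply: none; exists i.
Qed.

Lemma nat_bounded (f : nat -> R) (b : R) :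
  (exists N, forall i, (N <= i)%N -> f i <= b) ->
  exists2 D : R, 0 < D & forall i, f i <= D.
Proof.
move=> [N fN]; have [|D D0 fD] := @for_large_bounded _ (fun k => f (absz k)) b.
  by exists N => n; apply: fN.
by exists D => // i; have := fD i%:Z.
Qed.

End Regimes.

Section LogarithmicGaps.
Variables (R : realType) (a : int -> R) (delta : R).
Hypothesis a_incr : {homo a : n m / n < m}.
Hypothesis delta_gt0 : 0 < delta.
Hypothesis a_sep : forall n m : int, n != m -> delta < `|a n - a m|.

Let w := step_weight a.

Let w_gt0 k : 0 < w k. Proof. exact: lt_le_trans (step_weight_ge a_incr a_sep k). Qed.

Lemma gap_pos n : 0 < n -> gap a n = w n.
Proof. by rewrite /gap => ->. Qed.

Lemma gap_neg n : n <= 0 -> gap a n = w (n - 1).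
Proof. by rewrite /gap leNgt => /negPf ->; rewrite /w /step_weight subrK. Qed.

Lemma step_weight_regular : asymp (fun n => gap a (n + 1)) (gap a) ->
  exists2 C : R, 1 <= C & forall k : int, w (k + 1) <= C * w k /\ w k <= C * w (k + 1).
Proof.
move=> [c1 [c2 [c10 c20 reg]]].
have reg1 := for_large_shift 1 reg.
have large2 : for_large_abs (fun k : int => (2 <= absz k)%N) by exists 2%N.
have [C C0 HC] : exists2 C : R, 0 < C &
    forall k, w (k + 1) / w k + w k / w (k + 1) <= C.
  apply: (@for_large_bounded _ _ (c1^-1 + c2)).
  apply: for_largeW (for_largeI large2 (for_largeI reg reg1)) => k [k2 [h1 h2]].
  have : c1 * w (k + 1) <= w k <= c2 * w (k + 1).
    have [k0|k0] := ltP 0 k.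
      by move: h1; rewrite !gap_pos //; lia.
    move: h2; rewrite !gap_neg; [|lia|lia].
    by rewrite !addrK.
  move=> /andP[l1 l2]; apply: lerD; last by rewrite ler_pdivrMr.
  by rewrite ler_pdivrMr // -ler_pdivrMl ?invr_gt0 // invrK.
exists (1 + C); first by rewrite lerDl ltW.
move=> k; have := HC k; have w0 := w_gt0 k; have w1 := w_gt0 (k + 1).
have d1 : 0 < w (k + 1) / w k by rewrite divr_gt0.
have d2 : 0 < w k / w (k + 1) by rewrite divr_gt0.
by move=> h; split; rewrite -ler_pdivrMr //; lra.
Qed.

(** All gaps satisfy w_k = O(ln (2 + |a_k|)), and the logarithm at a_k exceeds the one
    at a_n by O(sqrt |a_k - a_n|) only.  This settles the case where
    ln (2 + |a_n|) = O(w_n^(3/2)).  By [regular_dichotomy], on each side of the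
    sequence either this holds, or all gaps are bounded; in the second case only
    gaps of the other side remain to be bounded, and those are seen from a_0 at a
    smaller distance than from a_n. *)
Lemma step_weight_dominated : log_gap_condition a -> exists2 B : R, 0 <= B &
  forall n k, w k <= B * (w n * Num.sqrt (w n) + Num.sqrt `|a k - a n|).
Proof.
move=> [reg def [c c0 lower] [c' c'0 upper]].
have [C C1 wC] := step_weight_regular reg.
have C0 : 0 <= C by lra.
have big := sep_large a_incr delta_gt0 a_sep.
pose L k := shifted_ln (a k).
have L0 k : 0 < L k by exact: shifted_ln_gt0.
have lnL k : 1 <= `|a k| -> ln `|a k| <= L k.
  by move=> h; apply: le_ln; lra.
have Lln k : 2 <= `|a k| -> L k <= 2 * ln `|a k|.
  move=> h; have -> : 2 * ln `|a k| = ln (`|a k| ^+ 2).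
    by rewrite lnXn ?mulr_natl //; lra.
  by apply: le_ln; have := normr_ge0 (a k); nra.
have prev k : w k <= C * w (k - 1) by have [+ _] := wC (k - 1); rewrite subrK.
have prev' k : w (k - 1) <= C * w k by have [_] := wC (k - 1); rewrite subrK.
have [C1' C1'0 wL] : exists2 D : R, 0 < D & forall k, w k <= D * L k.
  have [|D D0 HD] := @for_large_bounded _ (fun k => w k / L k) (C * c').
    apply: for_largeW (for_largeI upper (big 1)) => k [h1 h2].
    rewrite ler_pdivrMr // -mulrA.
    have : gap a k <= c' * L k.
      by apply: (le_trans h1); rewrite ler_wpM2l // lnL.
    have [k0|k0] := ltP 0 k.
      rewrite gap_pos // => h; apply: (le_trans h).
      by rewrite ler_peMl // mulr_ge0 // ltW.
    rewrite gap_neg // => h; apply: le_trans (prev k) _.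
    by rewrite ler_wpM2l.
  by exists D => // k; have := HD k; rewrite ler_pdivrMr.
pose T k := w k * Num.sqrt (w k).
pose tau := delta * Num.sqrt delta.
have tau0 : 0 < tau by rewrite mulr_gt0 // sqrtr_gt0.
have tauT k : tau <= T k.
  by apply: ler_pM; rewrite ?sqrtr_ge0 ?ler_wsqrtr ?(ltW delta_gt0) //; exact: (step_weight_ge a_incr a_sep).
have T0 k : 0 < T k by exact: lt_le_trans (tauT k).
have constT x k : 0 <= x -> x <= x / tau * T k.
  by move=> x0; rewrite mulrAC ler_pdivlMr // ler_wpM2l.
have Tprev k : T (k - 1) <= C * C * T k.
  rewrite /T; have -> : C * C * (w k * Num.sqrt (w k)) =
    (C * w k) * (C * Num.sqrt (w k)) by ring.
  apply: ler_pM; rewrite ?sqrtr_ge0 ?(ltW (w_gt0 _)) //.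
  apply: (@le_trans _ _ (Num.sqrt (C ^+ 2 * w k))).
    rewrite ler_wsqrtr //; apply: le_trans (prev' k) _.
    by rewrite ler_wpM2r ?(ltW (w_gt0 k)) // expr2 ler_peMl.
  by rewrite sqrtrM ?sqr_ge0 // sqrtr_sqr ger0_norm.
have linf (s : nat -> int) : (forall i, absz (s i) = i) ->
    forall A, exists N, forall i, (N <= i)%N -> A <= ln `|a (s i)|.
  move=> si A; have [N HN] := big (expR A); exists N => i Ni.
  have := HN (s i); rewrite si => /(_ Ni) h.
  by rewrite -[A]expRK; apply: le_ln => //; exact: expR_gt0.
have info (s : nat -> int) : (forall i, absz (s i) = i) ->
    exists N, forall i, (N <= i)%N -> [/\ 1 < gap a (s i), ln (ln (gap a (s i))) != 0 &
      ln `|a (s i)| / ln (ln (gap a (s i))) <= c * gap a (s i)].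
  move=> si; have [N HN] := for_largeI def lower; exists N => i Ni.
  by have := HN (s i); rewrite si => /(_ Ni)[[_ ? ?] ?].
(* The gap condition at index -i concerns w_(-i-1), hence the shift on the left
   side, which regularity absorbs. *)
have right_side : exists2 D : R, 0 < D &
    (forall n, 0 <= n -> L n <= D * T n) \/ (forall n, 0 <= n -> w n <= D).
  have absr (i : nat) : absz (i.+1%:Z - 1) = i by lia.
  have := @regular_dichotomy _ (fun i => w i%:Z) (fun i => ln `|a i%:Z|) C c C1 c0.
  case=> [i|i|A|||].
  - exact: w_gt0.
  - by have [+ _] := wC i%:Z; have -> : i%:Z + 1 = i.+1%:Z by lia.
  - exact: (linf (fun i => i%:Z)).
  - have [N HN] := info (fun i => i%:Z) (fun i => erefl).
    exists N.+1 => i Ni; have := HN i (ltnW Ni); rewrite gap_pos //; lia.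
  - move=> [N HN]; have [N2 HN2] := big 2.
    have [|D D0 HD] := @nat_bounded _ (fun i => L i%:Z / T i%:Z) (4 * c).
      exists (maxn N N2) => i; rewrite geq_max => /andP[i1 i2].
      rewrite ler_pdivrMr //; have := HN i i1; have := Lln _ (HN2 i%:Z i2).
      by rewrite -/(T _); lra.
    exists D => //; left=> -[i|//] _.
    by have := HD i; rewrite ler_pdivrMr.
  - move=> /nat_bounded[D D0 HD]; exists D => //; right=> -[i|//] _; exact: HD.
have left_side : exists2 D : R, 0 < D &
    (forall n, n <= 0 -> L n <= D * T n) \/ (forall n, n <= 0 -> w n <= D).
  have := @regular_dichotomy _ (fun i : nat => w (- i%:Z - 1))
    (fun i : nat => ln `|a (- i%:Z)|) C c C1 c0.
  case=> [i|i|A|||].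
  - exact: w_gt0.
  - by have := prev' (- i.+1%:Z); have -> : - i%:Z - 1 = - i.+1%:Z by lia.
  - by apply: (linf (fun i => - i%:Z)) => i; rewrite abszN.
  - have [|N HN] := info (fun i => - i%:Z); first by move=> i; rewrite abszN.
    by exists N => i Ni; have := HN i Ni; rewrite gap_neg //; lia.
  - move=> [N HN]; have [N2 HN2] := big 2.
    have [|D D0 HD] := @nat_bounded _ (fun i => L (- i%:Z) / T (- i%:Z)) (4 * c * (C * C)).
      exists (maxn N N2) => i; rewrite geq_max => /andP[i1 i2].
      rewrite ler_pdivrMr //; have := HN i i1.
      have : L (- i%:Z) <= 2 * ln `|a (- i%:Z)| by apply: Lln; apply: HN2; rewrite abszN.
      have : 4 * c * T (- i%:Z - 1) <= 4 * c * (C * C * T (- i%:Z)).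
        by rewrite ler_wpM2l ?mulr_ge0.
      by rewrite -/(T _); lra.
    exists D => //; left=> n n0; have := HD (absz n); rewrite ler_pdivrMr //.
    by have -> : - (absz n)%:Z = n by lia.
  - move=> /nat_bounded[D D0 HD]; exists (C * D); first by rewrite mulr_gt0 //; lra.
    right=> n n0; apply: le_trans (prev n) _; rewrite ler_wpM2l //.
    by have := HD (absz n); have -> : - (absz n)%:Z - 1 = n - 1 by lia.
have [D1 D10 right1] := right_side; have [D2 D20 left1] := left_side.
pose D := D1 + D2.
have D0 : 0 < D by rewrite addr_gt0.
have D1D : D1 <= D by rewrite lerDl ltW.
have D2D : D2 <= D by rewrite lerDr ltW.
pose B := C1' * D + D / tau + C1' * (L 0) / tau + 2 * C1'.
have b1 : 0 <= C1' * D by rewrite mulr_ge0 // ltW.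
have b2 : 0 <= D / tau by rewrite divr_ge0 // ltW.
have b3 : 0 <= C1' * (L 0) / tau by rewrite divr_ge0 ?mulr_ge0 // ltW.
exists B; first by rewrite /B; lra.
move=> n k; rewrite -/(T n); set r := Num.sqrt _.
have r0 : 0 <= r by exact: sqrtr_ge0.
have BT : B * (T n + r) = C1' * D * T n + D / tau * T n + C1' * (L 0) / tau * T n +
   2 * C1' * T n + (C1' * D + D / tau + C1' * (L 0) / tau) * r + 2 * C1' * r.
  by rewrite /B; ring.
have t1 : 0 <= C1' * D * T n by rewrite mulr_ge0 // ltW.
have t2 : 0 <= D / tau * T n by rewrite mulr_ge0 // ltW.
have t3 : 0 <= C1' * (L 0) / tau * T n by rewrite mulr_ge0 // ltW.
have t4 : 0 <= 2 * C1' * T n by rewrite !mulr_ge0 // ltW.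
have t5 : 0 <= (C1' * D + D / tau + C1' * (L 0) / tau) * r.
  by rewrite mulr_ge0 // !addr_ge0.
have t6 : 0 <= 2 * C1' * r by rewrite !mulr_ge0 // ltW.
have good : L n <= D * T n -> w k <= B * (T n + r).
  move=> Ln; apply: le_trans (wL k) _.
  have : C1' * L k <= C1' * (D * T n + 2 * r).
    rewrite ler_wpM2l ?(ltW C1'0) //.
    by apply: le_trans (shifted_ln_sub (a n) (a k)) _; rewrite lerD2r.
  by rewrite BT; lra.
have bounded : w k <= D -> w k <= B * (T n + r).
  by move=> wD; have := constT D n (ltW D0); rewrite BT; lra.
have across : `|a k - a 0| <= `|a k - a n| -> w k <= B * (T n + r).
  move=> ak; apply: le_trans (wL k) _.
  have : C1' * L k <= C1' * (L 0 + 2 * r).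
    rewrite ler_wpM2l ?(ltW C1'0) //.
    apply: le_trans (shifted_ln_sub (a 0) (a k)) _; rewrite lerD2l.
    by rewrite ler_wpM2l // ler_wsqrtr.
  have := constT (C1' * L 0) n (mulr_ge0 (ltW C1'0) (ltW (L0 0))).
  by rewrite BT; lra.
have [n0|n0] := leP 0 n.
  case: right1 => h1.
    by apply: good; apply: (le_trans (h1 n n0)); rewrite ler_wpM2r // ltW.
  have [k0|k0] := leP 0 k; first by apply: bounded; apply: le_trans (h1 k k0) _.
  apply: across; have : a k <= a 0 by apply: (incr_le a_incr); exact: ltW.
  have : a 0 <= a n by exact: (incr_le a_incr).
  by move=> u1 u2; apply: ler_dist_between; rewrite u1 u2.
case: left1 => h1.
  apply: good; apply: (le_trans (h1 n (ltW n0))); rewrite ler_wpM2r //.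
  exact: ltW.
have [k0|k0] := leP k 0; first by apply: bounded; apply: le_trans (h1 k k0) _.
apply: across; have : a 0 <= a k by apply: (incr_le a_incr); exact: ltW.
have : a n <= a 0 by apply: (incr_le a_incr); exact: ltW.
by move=> u1 u2; apply: ler_dist_between; rewrite u1 u2 orbT.
Qed.

End LogarithmicGaps.

(** * Conclusion *)

(** The three bounds say that the regular part of the Herglotz function near a_n has
    bounded slope and is O(sqrt w_n): what [derive_bound] asks for. *)
Lemma inner_function_of_weights (R : realType) (a w : int -> R)
    (delta K c K' : R) (g : int -> R) :
  0 < delta -> (forall n m : int, n != m -> delta < `|a n - a m|) ->
  (forall x, exists n, nearest a n x) ->
  0 < c -> (forall k, c <= w k) -> 0 <= K' ->
  (forall n N, psum (fun k => w k / (a k - a n) ^+ 2) N <= K) ->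
  (forall n x, nearest a n x -> \forall N \near \oo,
     `|psum (fun k => w k * ((if k == n then 0 else (a k - x)^-1) -
         (a k - a 0)^-1)) N| <= g n) ->
  (forall n, g n ^+ 2 <= K' * w n) ->
  exists Theta : cplx R -> cplx R,
    [/\ meromorphic_inner_function Theta,
        spectrum Theta = range a &
        exists M : R, forall x : R, `|derive1 Theta (ofreal x)| <= ofreal M].
Proof.
move=> delta0 sep near c0 cw K'0 wK wg gw.
have w0 k : 0 < w k by apply: lt_le_trans (cw k).
exists (theta a w); split.
- split; first exact: (theta_inner delta0 sep near w0 wK).
  exact: (theta_meromorphic delta0 sep near w0 wK).
- exact: (theta_spectrum delta0 sep near w0 wK).
- exact: (theta_derive_bound delta0 sep near w0 wK c0 K'0 cw wg gw).
Qed.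

Theorem theorem4 (R : realType) (a : int -> R)
    (a_sep : separated_seq a)
    (a_incr : {homo a : n m / n < m})
    (a_pinfty : a n%:Z @[n --> \oo] --> +oo)
    (a_ninfty : a (- n%:Z) @[n --> \oo] --> -oo)
    (a_cond : [\/ log_gap_condition a, large_gap_condition a
                | cluster_condition a]) :
  exists Theta : cplx R -> cplx R,
    [/\ meromorphic_inner_function Theta,
        spectrum Theta = range a &
        exists M : R, forall x : R, `|derive1 Theta (ofreal x)| <= ofreal M].
Proof.
have [delta delta0 sep] := a_sep.
have pinf A : exists n, A <= a n.
  have /cvgryPge/(_ A)[N _ HN] := a_pinfty.
  by exists N%:Z; apply: HN; rewrite /= leqnn.
have ninf A : exists n, a n <= A.
  have /cvgrNyPle/(_ A)[N _ HN] := a_ninfty.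
  by exists (- N%:Z); apply: HN; rewrite /= leqnn.
have near := exists_nearest a_incr pinf ninf.
have unit_case (M : nat) : (0 < M)%N -> (exists2 c : R, 0 < c & forall j : int,
    c * ln (2 + (absz j)%:R) ^+ 2 <= a (j + M%:Z) - a j) ->
    exists Theta : cplx R -> cplx R,
    [/\ meromorphic_inner_function Theta,
        spectrum Theta = range a &
        exists M : R, forall x : R, `|derive1 Theta (ofreal x)| <= ofreal M].
  move=> M0 [c c0 gapM].
  have [S S0 HS] := inverse_sum_bounded a_incr delta0 sep M0 c0 gapM.
  apply: (@inner_function_of_weights _ a (fun=> 1) delta (delta^-1 * S) 1
    ((3 * S) ^+ 2) (fun=> 3 * S)) => //.
  - exact: sqr_ge0.
  - exact: unit_square_sum delta0 sep HS.
  - move=> n x nx; apply: nearW => N; exact: (unit_balance delta0 sep HS N nx).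
  - by move=> n; rewrite mulr1.
case: a_cond => [cond|cond|cond].
- have [C C1 reg] := step_weight_regular a_incr delta0 sep (let: And4 r _ _ _ := cond in r).
  have [B B0 star] := step_weight_dominated a_incr delta0 sep cond.
  have [P P0 bal] :=
    step_weight_balance a_incr delta0 sep C1 reg B0 star pinf ninf.
  apply: (@inner_function_of_weights _ a (step_weight a) delta _ delta (P ^+ 2)
    (fun n => P * Num.sqrt (step_weight a n))) => //.
  + exact: step_weight_ge.
  + exact: sqr_ge0.
  + exact: step_weight_square_sum a_incr delta0 sep C1 reg.
  + move=> n; rewrite exprMn sqr_sqrtr //.
    by apply: le_trans (step_weight_ge a_incr sep n); exact: ltW.
- apply: (unit_case 1%N) => //; exact: large_gap_growth delta0 sep cond.
- have [M [M0 gapM]] := cluster_growth a_incr delta0 sep pinf ninf cond.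
  exact: unit_case M0 gapM.
Qed.
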